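(* Let $H\le F_n$ be a finitely generated subgroup and let $g\in F_n$ be an element. Then: (i) The ideal $\mathfrak I_g\trianglelefteq H*\langle x\rangle$ is finitely generated as a normal subgroup. (ii) The set of (normal) generators for $\mathfrak I_g$ can be taken to be a subset of a basis for the free group $H*\langle x\rangle$. (iii) There is an algorithm that, given $H$ and $g$, computes a finite set of normal generators for $\mathfrak I_g$ which is also a subset of a basis for $H*\langle x\rangle$.
   Context: $F_n$ is the free group with basis $a_1,\dots,a_n$, and $\langle x\rangle\cong\mathbb Z$ is infinite cyclic. For $g\in F_n$ let $\varphi_g:H*\langle x\rangle\to F_n$ be the homomorphism that is the inclusion on $H$ and sends $x$ to $g$, and let $\mathfrak I_g=\ker\varphi_g$, a normal subgroup of $H*\langle x\rangle$. When an algorithm takes a finitely generated subgroup $H\le F_n$ as input, $H$ is given by a finite set of generators, each given as a word in the basis $a_1,\dots,a_n$. *)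

(* Defs.v *)
From HB Require Import structures.
From mathcomp Require Import all_boot.
From mathcomp Require Import boolp classical_sets.

Set Implicit Arguments.
Unset Strict Implicit.
Unset Printing Implicit Defensive.

Local Open Scope group_scope.

(* The letter [(t, false)] is t and [(t, true)] is t^-1. *)
Definition word (T : Type) := seq (T * bool).

Definition inv_letter (T : Type) (l : T * bool) : T * bool := (l.1, ~~ l.2).

Lemma inv_letterK (T : Type) : involutive (@inv_letter T).
Proof. by case=> t b; rewrite /inv_letter /= negbK. Qed.

Definition eval_letter (T : Type) (G : groupType) (f : T -> G) (l : T * bool)
  : G := if l.2 then (f l.1)^-1 else f l.1.

Definition eval_word (T : Type) (G : groupType) (f : T -> G) (w : word T) : G :=
  \prod_(l <- w) eval_letter f l.

Section FreeGroup.
Variable T : choiceType.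
Implicit Types (u v w : word T) (l : T * bool).

Definition reduced w := sorted (fun l l' => l' != inv_letter l) w.

Definition push l w : word T :=
  if w is l' :: w' then if l' == inv_letter l then w' else l :: w else [:: l].

Definition word_mul u v : word T := foldr push v u.

Definition word_inv w : word T := rev (map (@inv_letter T) w).

Lemma push_reduced l w : reduced w -> reduced (push l w).
Proof.
case: w => [|l' w] //= w_red; case: ifP => [_|/negbT nl].
  by case: w w_red => [|l'' w] //= /andP[].
by rewrite /= nl.
Qed.

Lemma word_mul_reduced u v : reduced v -> reduced (word_mul u v).
Proof. by move=> vr; elim: u => //= l u; apply: push_reduced. Qed.

Lemma word_inv_reduced w : reduced w -> reduced (word_inv w).
Proof.
rewrite /reduced /word_inv rev_sorted sorted_map; apply: sub_sorted => l l' /=.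
by apply: contra => /eqP ->; rewrite !inv_letterK.
Qed.

Lemma pushK l w : reduced w -> push (inv_letter l) (push l w) = w.
Proof.
case: w => [|l' w] /=; first by rewrite inv_letterK eqxx.
move=> w_red; case: eqP => [e|_] /=; last by rewrite inv_letterK eqxx.
by case: w w_red => [|l'' w] /=; rewrite e // => /andP[/negbTE ->].
Qed.

Lemma word_mul_push l u v :
  reduced v -> word_mul (push l u) v = push l (word_mul u v).
Proof.
move=> vr; case: u => [|l' u] //=; case: eqP => [->|] //=.
have /(pushK (inv_letter l)) := word_mul_reduced u vr.
by rewrite inv_letterK => ->.
Qed.

Lemma word_mulA u v w :
  reduced w -> word_mul u (word_mul v w) = word_mul (word_mul u v) w.
Proof. by move=> wr; elim: u => //= l u ->; rewrite word_mul_push. Qed.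

Lemma word_mul1 w : reduced w -> word_mul w [::] = w.
Proof.
elim: w => //= l w IHw w_red; rewrite IHw; last exact: path_sorted w_red.
by case: w w_red {IHw} => //= l' w /andP[/negbTE ->].
Qed.

Lemma word_mulV w : word_mul (word_inv w) w = [::].
Proof.
elim: w => //= l w; rewrite /word_inv /= rev_cons /word_mul foldr_rcons /=.
by rewrite inv_letterK eqxx.
Qed.

Lemma word_invK : involutive word_inv.
Proof.
by move=> w; rewrite /word_inv map_rev revK mapK //; apply: inv_letterK.
Qed.

(* Every element of the free group on T is a unique reduced word. *)
Definition free_group : Type := {w : word T | reduced w}.

HB.instance Definition _ := Choice.on free_group.

Definition free_one : free_group := exist _ [::] isT.
Definition free_mul (u v : free_group) : free_group :=
  exist _ (word_mul (val u) (val v)) (word_mul_reduced (val u) (valP v)).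
Definition free_inv (u : free_group) : free_group :=
  exist _ (word_inv (val u)) (word_inv_reduced (valP u)).

Lemma free_mulA : associative free_mul.
Proof.
by move=> u v w; apply: val_inj; rewrite /= word_mulA //; apply: valP w.
Qed.

Lemma free_mul1 : left_id free_one free_mul.
Proof. by move=> u; apply: val_inj. Qed.

Lemma free_1mul : right_id free_one free_mul.
Proof. by move=> u; apply: val_inj; apply: word_mul1 (valP u). Qed.

Lemma free_mulV : left_inverse free_one free_inv free_mul.
Proof. by move=> u; apply: val_inj; apply: word_mulV. Qed.

Lemma free_Vmul : right_inverse free_one free_inv free_mul.
Proof.
move=> u; apply: val_inj; rewrite /= -[X in word_mul X _]word_invK.
exact: word_mulV.
Qed.

HB.instance Definition _ := isGroup.Build free_group
  free_mulA free_mul1 free_1mul free_mulV free_Vmul.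

Definition free_gen (t : T) : free_group := exist _ [:: (t, false)] isT.

Variables (G : groupType) (f : T -> G).

Definition free_lift (u : free_group) : G := eval_word f (val u).

Lemma eval_push l w : eval_word f (push l w) = eval_letter f l * eval_word f w.
Proof.
case: w => [|l' w] /=; first by rewrite /eval_word big_cons.
case: eqP => [->|_]; rewrite /eval_word !big_cons //.
by rewrite mulgA; case: l => t []; rewrite /= (mulVg, mulgV) mul1g.
Qed.

Lemma free_liftM : {morph free_lift : u v / u * v}.
Proof.
move=> [u ur] [v vr]; rewrite /free_lift /=.
elim: u {ur} => [|l u IHu] /=; first by rewrite {2}/eval_word big_nil mul1g.
by rewrite eval_push IHu mulgA /eval_word big_cons.
Qed.

HB.instance Definition _ := isMultiplicative.Build _ _ free_lift free_liftM.

Lemma free_lift_gen t : free_lift (free_gen t) = f t.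
Proof. by rewrite /free_lift /eval_word big_seq1. Qed.

End FreeGroup.

Notation "''F' n" := (free_group 'I_n) (at level 8, n at level 2).

Section FreeProduct.
Variables A B : groupType.

(* The free product A * B consists of the words over the disjoint union of A and
   B modulo the congruence generated by the multiplication tables. *)
Inductive fprod_cong : seq (A + B) -> seq (A + B) -> Prop :=
| cong_refl u : fprod_cong u u
| cong_sym u v : fprod_cong u v -> fprod_cong v u
| cong_trans v u w : fprod_cong u v -> fprod_cong v w -> fprod_cong u w
| cong_one1 u v : fprod_cong (u ++ inl 1 :: v) (u ++ v)
| cong_one2 u v : fprod_cong (u ++ inr 1 :: v) (u ++ v)
| cong_mul1 u v a a' :
    fprod_cong (u ++ inl a :: inl a' :: v) (u ++ inl (a * a') :: v)
| cong_mul2 u v b b' :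
    fprod_cong (u ++ inr b :: inr b' :: v) (u ++ inr (b * b') :: v).

Definition fprod_rel (u v : seq (A + B)) : bool := `[< fprod_cong u v >].

Lemma fprod_rel_refl : reflexive fprod_rel.
Proof. by move=> u; apply/asboolP; apply: cong_refl. Qed.

Lemma fprod_rel_sym : symmetric fprod_rel.
Proof. by move=> u v; apply/asboolP/asboolP; apply: cong_sym. Qed.

Lemma fprod_rel_trans : transitive fprod_rel.
Proof.
move=> v u w /asboolP uv /asboolP vw; apply/asboolP.
exact: cong_trans uv vw.
Qed.

Canonical fprod_equiv :=
  EquivRel fprod_rel fprod_rel_refl fprod_rel_sym fprod_rel_trans.

Definition fprod : Type := {eq_quot fprod_equiv}%qT.

HB.instance Definition _ := EqQuotient.on fprod.
HB.instance Definition _ := Choice.on fprod.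

Definition fprod_pi (u : seq (A + B)) : fprod := \pi_fprod%qT u.

Lemma fprod_piP u v : fprod_pi u = fprod_pi v <-> fprod_cong u v.
Proof.
by split=> [/eqquotP/asboolP // | uv]; apply/eqquotP/asboolP.
Qed.

Lemma fprod_piW (P : fprod -> Prop) : (forall u, P (fprod_pi u)) -> forall x, P x.
Proof. exact: quotW. Qed.

Lemma fprod_reprP u : fprod_cong (repr (fprod_pi u)) u.
Proof. by apply/fprod_piP; rewrite /fprod_pi reprK. Qed.

Lemma fprod_cong_catl w u v : fprod_cong u v -> fprod_cong (w ++ u) (w ++ v).
Proof.
move=> uv; elim: uv => {u v}; first by move=> u; apply: cong_refl.
- by move=> u v _; apply: cong_sym.
- by move=> v u x _ uv _; apply: cong_trans uv.
- by move=> u v; rewrite !(catA w); apply: cong_one1.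
- by move=> u v; rewrite !(catA w); apply: cong_one2.
- by move=> u v a a'; rewrite !(catA w); apply: cong_mul1.
- by move=> u v b b'; rewrite !(catA w); apply: cong_mul2.
Qed.

Lemma fprod_cong_catr w u v : fprod_cong u v -> fprod_cong (u ++ w) (v ++ w).
Proof.
move=> uv; elim: uv => {u v}; first by move=> u; apply: cong_refl.
- by move=> u v _; apply: cong_sym.
- by move=> v u x _ uv _; apply: cong_trans uv.
- by move=> u v; rewrite -!catA; apply: cong_one1.
- by move=> u v; rewrite -!catA; apply: cong_one2.
- by move=> u v a a'; rewrite -!catA; apply: cong_mul1.
- by move=> u v b b'; rewrite -!catA; apply: cong_mul2.
Qed.

Lemma fprod_cong_cat u u' v v' :
  fprod_cong u u' -> fprod_cong v v' -> fprod_cong (u ++ v) (u' ++ v').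
Proof.
move=> uu vv; apply: cong_trans (fprod_cong_catr v uu) _.
exact: fprod_cong_catl.
Qed.

Definition fprod_letter_inv (s : A + B) : A + B :=
  match s with inl a => inl a^-1 | inr b => inr b^-1 end.

Definition fprod_word_inv (u : seq (A + B)) := rev (map fprod_letter_inv u).

Lemma fprod_word_inv_cat u v :
  fprod_word_inv (u ++ v) = fprod_word_inv v ++ fprod_word_inv u.
Proof. by rewrite /fprod_word_inv map_cat rev_cat. Qed.

Lemma fprod_cong_inv u v :
  fprod_cong u v -> fprod_cong (fprod_word_inv u) (fprod_word_inv v).
Proof.
have catE s w : fprod_word_inv (s :: w) =
    fprod_word_inv w ++ [:: fprod_letter_inv s].
  by rewrite -cat1s fprod_word_inv_cat.
move=> uv; elim: uv => {u v}; first by move=> u; apply: cong_refl.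
- by move=> u v _; apply: cong_sym.
- by move=> v u x _ uv _; apply: cong_trans uv.
all: move=> u v *; rewrite !fprod_word_inv_cat !catE -!catA /= ?invg1 ?invgM.
- exact: cong_one1.
- exact: cong_one2.
- exact: cong_mul1.
- exact: cong_mul2.
Qed.

Lemma fprod_word_mulV u : fprod_cong (fprod_word_inv u ++ u) [::].
Proof.
elim: u => [|s u IHu]; first exact: cong_refl.
rewrite -cat1s fprod_word_inv_cat -catA.
apply: cong_trans _ IHu; apply: fprod_cong_catl; rewrite catA.
rewrite -[X in fprod_cong _ X]cat0s; apply: fprod_cong_catr.
case: s => s; rewrite /fprod_word_inv /=.
  apply: cong_trans (cong_mul1 [::] [::] _ _) _.
  by rewrite mulVg; apply: cong_one1.
apply: cong_trans (cong_mul2 [::] [::] _ _) _.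
by rewrite mulVg; apply: cong_one2.
Qed.

Lemma fprod_word_invK : involutive fprod_word_inv.
Proof.
move=> u; rewrite /fprod_word_inv map_rev revK mapK //.
by case=> s /=; rewrite invgK.
Qed.

Definition fprod_one : fprod := fprod_pi [::].
Definition fprod_mul (x y : fprod) : fprod := fprod_pi (repr x ++ repr y).
Definition fprod_inv (x : fprod) : fprod := fprod_pi (fprod_word_inv (repr x)).

Lemma fprod_mulE u v : fprod_mul (fprod_pi u) (fprod_pi v) = fprod_pi (u ++ v).
Proof. by apply/fprod_piP/fprod_cong_cat; apply: fprod_reprP. Qed.

Lemma fprod_invE u : fprod_inv (fprod_pi u) = fprod_pi (fprod_word_inv u).
Proof. by apply/fprod_piP/fprod_cong_inv/fprod_reprP. Qed.

Lemma fprod_mulA : associative fprod_mul.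
Proof.
elim/fprod_piW=> u; elim/fprod_piW=> v; elim/fprod_piW=> w.
by rewrite !fprod_mulE catA.
Qed.

Lemma fprod_mul1 : left_id fprod_one fprod_mul.
Proof. by elim/fprod_piW=> u; rewrite fprod_mulE. Qed.

Lemma fprod_1mul : right_id fprod_one fprod_mul.
Proof. by elim/fprod_piW=> u; rewrite fprod_mulE cats0. Qed.

Lemma fprod_mulV : left_inverse fprod_one fprod_inv fprod_mul.
Proof.
elim/fprod_piW=> u; rewrite fprod_invE fprod_mulE.
exact/fprod_piP/fprod_word_mulV.
Qed.

Lemma fprod_Vmul : right_inverse fprod_one fprod_inv fprod_mul.
Proof.
elim/fprod_piW=> u; rewrite -{1}[u]fprod_word_invK fprod_invE fprod_mulE.
exact/fprod_piP/fprod_word_mulV.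
Qed.

HB.instance Definition _ := isGroup.Build fprod
  fprod_mulA fprod_mul1 fprod_1mul fprod_mulV fprod_Vmul.

Definition fprod_inl (a : A) : fprod := fprod_pi [:: inl a].
Definition fprod_inr (b : B) : fprod := fprod_pi [:: inr b].

Lemma fprod_inlM : {morph fprod_inl : a a' / a * a'}.
Proof.
move=> a a'; rewrite [RHS]fprod_mulE; apply/fprod_piP/cong_sym.
exact: (@cong_mul1 [::] [::]).
Qed.

Lemma fprod_inrM : {morph fprod_inr : b b' / b * b'}.
Proof.
move=> b b'; rewrite [RHS]fprod_mulE; apply/fprod_piP/cong_sym.
exact: (@cong_mul2 [::] [::]).
Qed.

HB.instance Definition _ := isMultiplicative.Build _ _ fprod_inl fprod_inlM.
HB.instance Definition _ := isMultiplicative.Build _ _ fprod_inr fprod_inrM.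

Section Lift.
Variables (G : groupType).
Variables (f : {multiplicative A -> G}) (h : {multiplicative B -> G}).

Definition fprod_eval (u : seq (A + B)) : G :=
  \prod_(s <- u) match s with inl a => f a | inr b => h b end.

Lemma fprod_eval_cat u v : fprod_eval (u ++ v) = fprod_eval u * fprod_eval v.
Proof. exact: big_cat. Qed.

Lemma fprod_eval_cong u v : fprod_cong u v -> fprod_eval u = fprod_eval v.
Proof.
have morph1 (K : groupType) (k : {multiplicative K -> G}) : k 1 = 1.
  by apply: (@mulgI _ (k 1)); rewrite -gmulfM !mulg1.
move=> uv; elim: uv => {u v} //; first by move=> v u w _ -> _ ->.
all: move=> u v *; rewrite !fprod_eval_cat; congr (_ * _).
all: by rewrite /fprod_eval !big_cons ?morph1 ?mul1g // gmulfM mulgA.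
Qed.

Definition fprod_lift (x : fprod) : G := fprod_eval (repr x).

Lemma fprod_liftE u : fprod_lift (fprod_pi u) = fprod_eval u.
Proof. exact/fprod_eval_cong/fprod_reprP. Qed.

Lemma fprod_liftM : {morph fprod_lift : x y / x * y}.
Proof.
elim/fprod_piW=> u; elim/fprod_piW=> v; rewrite [X in fprod_lift X]fprod_mulE.
by rewrite !fprod_liftE fprod_eval_cat.
Qed.

HB.instance Definition _ := isMultiplicative.Build _ _ fprod_lift fprod_liftM.

Lemma fprod_lift_inl a : fprod_lift (fprod_inl a) = f a.
Proof. by rewrite fprod_liftE /fprod_eval big_seq1. Qed.

Lemma fprod_lift_inr b : fprod_lift (fprod_inr b) = h b.
Proof. by rewrite fprod_liftE /fprod_eval big_seq1. Qed.

End Lift.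
End FreeProduct.

Definition subgroup_of (G : groupType) (H : groupClosed G) : Type :=
  {y : G | y \in H}.

Section SubgroupOf.
Variables (G : groupType) (H : groupClosed G).

Lemma groupClosedP : group_closed (mem H).
Proof. by split; [apply: gpred1 | move=> x y; apply: gpredF]. Qed.

HB.instance Definition _ := SubChoice.on (subgroup_of H).
HB.instance Definition _ :=
  SubChoice_isSubGroup.Build G (mem H) (subgroup_of H) groupClosedP.

End SubgroupOf.

Section Generation.
Variable G : groupType.
Implicit Types (S B : set G) (N K : groupClosed G).

Definition generated S : {pred G} :=
  [pred y | `[< forall K, (forall s, S s -> s \in K) -> y \in K >]].

Lemma mem_generated S s : S s -> s \in generated S.
Proof. by move=> Ss; apply/asboolP => K; apply. Qed.

Lemma generated1 S : 1 \in generated S.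
Proof. by apply/asboolP => K _; apply: gpred1. Qed.

Lemma generatedM S : mulg_closed (generated S).
Proof.
move=> x y /asboolP Sx /asboolP Sy; apply/asboolP => K SK.
by apply: gpredM; [apply: Sx | apply: Sy].
Qed.

Lemma generatedV S : invg_closed (generated S).
Proof. by move=> x /asboolP Sx; apply/asboolP => K SK; apply/gpredVr/Sx. Qed.

HB.instance Definition _ S := isMulClosed.Build G (generated S) (@generatedM S).
HB.instance Definition _ S := isInvClosed.Build G (generated S) (@generatedV S).
HB.instance Definition _ S :=
  isMul1Closed.Build G (generated S) (generated1 S).

Definition fin_generated N := exists s : seq G, N =i generated [set` s].

Definition normal N := forall x y, x \in N -> x ^ y \in N.

Definition normal_closure S : set G :=
  [set y | forall N, normal N -> (forall s, S s -> s \in N) -> y \in N].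

(* The universal property: every map from B to a group extends uniquely to a
   homomorphism (only the values of f on B matter). *)
Definition is_basis B := forall (K : groupType) (f : G -> K),
  exists phi : {multiplicative G -> K},
    (forall b, B b -> phi b = f b) /\
    forall psi : {multiplicative G -> K}, (forall b, B b -> psi b = f b) ->
      psi =1 phi.

End Generation.

Definition kernel (G K : groupType) (phi : {multiplicative G -> K}) : set G :=
  [set y | phi y = 1].

(* The group H * <x>; the infinite cyclic group <x> is the free group on one
   generator. *)
Definition adjoin (n : nat) (H : groupClosed 'F n) : groupType :=
  fprod (subgroup_of H) (free_group unit).

Definition adjoin_x (n : nat) (H : groupClosed 'F n) : adjoin H :=
  fprod_inr _ (free_gen tt).

Definition eval_at (n : nat) (H : groupClosed 'F n) (g : 'F n) :
    {multiplicative adjoin H -> 'F n} :=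
  fprod_lift (\val : {multiplicative subgroup_of H -> 'F n})
             (free_lift (fun _ : unit => g)).

Arguments eval_at {n} H g.

Definition ideal (n : nat) (H : groupClosed 'F n) (g : 'F n) : set (adjoin H) :=
  kernel (eval_at H g).

Arguments ideal {n} H g.

Lemma eval_at_H (n : nat) (H : groupClosed 'F n) g (h : subgroup_of H) :
  eval_at H g (fprod_inl _ h) = val h.
Proof. exact: fprod_lift_inl. Qed.

Lemma eval_at_x (n : nat) (H : groupClosed 'F n) g :
  eval_at H g (adjoin_x H) = g.
Proof.
by rewrite [LHS]fprod_lift_inr; apply: free_lift_gen.
Qed.

(* Kleene's total recursive functions of several natural arguments.
   Minimization is the regular one (constructor [rec_min]): the minimum is
   required to exist for all values of the parameters. *)
Inductive recursive : forall k, (k.-tuple nat -> nat) -> Prop :=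
| rec_zero k : @recursive k (fun _ => 0)
| rec_succ : @recursive 1 (fun v => (thead v).+1)
| rec_proj k (i : 'I_k) : @recursive k (fun v => tnth v i)
| rec_comp k m (f : m.-tuple nat -> nat) (h : 'I_m -> k.-tuple nat -> nat) :
    recursive f -> (forall i, recursive (h i)) ->
    @recursive k (fun v => f [tuple h i v | i < m])
| rec_prim k (f : k.-tuple nat -> nat) (h : k.+2.-tuple nat -> nat)
    (r : k.+1.-tuple nat -> nat) :
    recursive f -> recursive h ->
    (forall v : k.-tuple nat, r [tuple of 0 :: v] = f v) ->
    (forall y (v : k.-tuple nat), r [tuple of y.+1 :: v] =
       h [tuple of y :: r [tuple of y :: v] :: v]) ->
    recursive r
| rec_min k (f : k.+1.-tuple nat -> nat) (r : k.-tuple nat -> nat) :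
    recursive f ->
    (forall v : k.-tuple nat, f [tuple of r v :: v] = 0) ->
    (forall (v : k.-tuple nat) y, y < r v -> f [tuple of y :: v] <> 0) ->
    recursive r.

Definition recursive1 (f : nat -> nat) : Prop :=
  @recursive 1 (fun v => f (thead v)).

(* [CodeSeq.code] is a computable bijection from lists of naturals to naturals;
   the letters t and t^-1 are coded by 2 c(t) and 2 c(t) + 1. *)
Definition word_code (T : Type) (c : T -> nat) (w : word T) : nat :=
  CodeSeq.code [seq (c l.1).*2 + nat_of_bool l.2 | l : T * bool <- w].

Definition words_code (T : Type) (c : T -> nat) (ws : seq (word T)) : nat :=
  CodeSeq.code [seq word_code c w | w <- ws].

(* [None] stands for x and [Some i] for the i-th given generator of H. *)
Definition letter_code (k : nat) (o : option 'I_k) : nat :=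
  if o is Some i then (i : nat).+1 else 0.

Definition word_val (n : nat) (w : word 'I_n) : 'F n :=
  eval_word (@free_gen 'I_n) w.

Definition span (n : nat) (ws : seq (word 'I_n)) : groupClosed 'F n :=
  GroupClosed.clone 'F n (generated [set` map (@word_val n) ws]) _.

Lemma word_val_span (n : nat) (ws : seq (word 'I_n)) (i : 'I_(size ws)) :
  word_val (tnth (in_tuple ws) i) \in span ws.
Proof. by apply: mem_generated; apply: map_f; apply: mem_tnth. Qed.

Definition span_gen (n : nat) (ws : seq (word 'I_n)) (i : 'I_(size ws)) :
  subgroup_of (span ws) :=
  exist (fun y => y \in span ws) _ (word_val_span i).

Definition adjoin_word_val (n : nat) (ws : seq (word 'I_n))
    (u : word (option 'I_(size ws))) : adjoin (span ws) :=
  eval_word (fun o => if o is Some i then fprod_inl _ (span_gen i)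
                      else adjoin_x (span ws)) u.

(* Main.v *)
(** Nielsen reduction, twice: a tuple of generators of H becomes trivial elements
    together with a Nielsen reduced tuple b, which is a basis of H; then the basis
    (x, b) of H * <x> is moved by an automorphism of H * <x> to a basis whose image
    under phi_g consists of trivial elements and of a Nielsen reduced tuple. As
    phi_g is injective on the span of the latter entries, its kernel is the normal
    closure of the former.

    Reduction itself is a minimization of the total length, ties being broken by
    the total rank of the initial halves. A Nielsen reduced tuple is free because
    the Cayley graph is a tree (four-point condition).

    Checking that given lists of Nielsen moves reduce the two tuples is primitive
    recursive in the codes, and suitable lists exist for every input, so that the
    algorithm is an unbounded search for them. *)

From HB Require Import structures.
Require Import Defs.
From mathcomp Require Import all_boot.
From mathcomp Require Import zify.
From mathcomp Require Import boolp classical_sets.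

Set Implicit Arguments.
Unset Strict Implicit.
Unset Printing Implicit Defensive.

Local Open Scope classical_set_scope.

(** * Computability *)

Section Recursive.

(** The given generators of H may satisfy relations, and only an independent tuple together with x
    can be moved by automorphisms; hence the separate reduction inside H. Freeness is split into
    generation ([spans]) and free choice of values ([extends]), each preserved by every Nielsen
    move. Minimal total length alone leaves one obstacle to being Nielsen reduced: an entry y of
    even length, one half of which cancels against a left neighbour and the other half against a
    right neighbour, with no change of length. Comparing the ranks of the initial halves of y and of
    its inverse excludes it. All tests of the algorithm concern elements of F_n, where equality is
    equality of reduced words. Elements of H * <x> are carried along as unreduced words in x and the
    given generators, so no normal form in the free product is ever computed. Minimality serves only
    to show that suitable moves exist; that they yield the kernel and a basis follows from the
    outcome of the test alone. *)

Definition recursive2 (h : nat -> nat -> nat) :=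
  @recursive 2 (fun v => h (tnth v ord0) (tnth v ord_max)).

Definition recursive3 (h : nat -> nat -> nat -> nat) :=
  @recursive 3 (fun v => h (tnth v ord0) (tnth v (inord 1)) (tnth v ord_max)).

Lemma recursive_ext k (f f' : k.-tuple nat -> nat) :
  f =1 f' -> recursive f -> recursive f'.
Proof. by move=> /funext ->. Qed.

Lemma recursive_comp1 k h (f : k.-tuple nat -> nat) :
  recursive1 h -> recursive f -> recursive (fun v => h (f v)).
Proof.
move=> hr fr.
apply: recursive_ext (rec_comp (h := fun _ : 'I_1 => f) hr (fun=> fr)) => v.
by rewrite /thead tnth_mktuple.
Qed.

Lemma recursive_comp2 k h (f g : k.-tuple nat -> nat) :
  recursive2 h -> recursive f -> recursive g ->
  recursive (fun v => h (f v) (g v)).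
Proof.
move=> hr fr gr.
have fgr (i : 'I_2) : recursive (if i == ord0 then f else g) by case: ifP.
by apply: recursive_ext (rec_comp hr fgr) => v; rewrite !tnth_mktuple.
Qed.

Lemma recursive_const k c : @recursive k (fun=> c).
Proof.
elim: c => [|c IHc]; first exact: rec_zero.
exact: recursive_comp1 rec_succ IHc.
Qed.

Lemma recursive1_id : recursive1 id.
Proof. exact: rec_proj. Qed.

Lemma recursive2_prim f h r :
  recursive1 f -> recursive3 h ->
  (forall x, r 0 x = f x) -> (forall y x, r y.+1 x = h y (r y x) x) ->
  recursive2 r.
Proof.
move=> fr hr r0 rS; apply: (rec_prim fr hr) => [v|y v].
  rewrite -r0; congr (r _ _); rewrite (tnth_nth 0) /thead (tnth_nth 0) //.
rewrite !(tnth_nth 0) /= inordK //= rS; congr (h _ _ _).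
all: by rewrite !(tnth_nth 0).
Qed.

Lemma recursive1_ext f g : f =1 g -> recursive1 f -> recursive1 g.
Proof. by move=> fg; apply: recursive_ext => v. Qed.

Lemma recursive1_swap h : recursive2 h -> recursive2 (fun x y => h y x).
Proof. by move=> hr; apply: recursive_comp2 hr _ _; apply: rec_proj. Qed.

Lemma recursive2_diag h : recursive2 h -> recursive1 (fun x => h x x).
Proof. by move=> hr; apply: recursive_comp2 hr _ _; apply: rec_proj. Qed.

Lemma recursive2_app1 h c : recursive2 h -> recursive1 (h^~ c).
Proof.
by move=> hr; apply: (recursive_comp2 hr); [exact: rec_proj | exact: recursive_const].
Qed.

Lemma recursive1_prim c h r :
  recursive2 h -> r 0 = c -> (forall y, r y.+1 = h y (r y)) -> recursive1 r.
Proof.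
move=> hr r0 rS.
suff rr : recursive2 (fun y _ => r y) by apply: recursive2_app1 0 rr.
apply: (@recursive2_prim (fun=> c) (fun y z _ => h y z)) => //.
  exact: recursive_const.
by apply: (recursive_comp2 hr); apply: rec_proj.
Qed.

Lemma recursive2_add : recursive2 addn.
Proof.
apply: (@recursive2_prim id (fun _ r _ => r.+1)) => //; first exact: rec_proj.
by apply: (recursive_comp1 rec_succ); apply: rec_proj.
Qed.

Lemma recursive2_mul : recursive2 muln.
Proof.
apply: (@recursive2_prim (fun=> 0) (fun _ r x => x + r)) => //.
  exact: recursive_const.
by apply: (recursive_comp2 recursive2_add); apply: rec_proj.
Qed.

Lemma recursive1_pred : recursive1 predn.
Proof.
by apply: (@recursive1_prim 0 (fun y _ => y)) => //; apply: rec_proj.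
Qed.

Lemma recursive2_sub : recursive2 subn.
Proof.
suff: recursive2 (fun y x => x - y) by move/recursive1_swap.
apply: (@recursive2_prim id (fun _ r _ => r.-1)) => [||x|y x].
- exact: rec_proj.
- by apply: (recursive_comp1 recursive1_pred); apply: rec_proj.
- exact: subn0.
- exact: subnS.
Qed.

Lemma recursive1_exp2 : recursive1 (expn 2).
Proof.
apply: (@recursive1_prim 1 (fun _ r => r + r)) => // [|y].
  by apply: (recursive_comp2 recursive2_add); apply: rec_proj.
by rewrite expnS mul2n addnn.
Qed.

Lemma recursive1_odd : recursive1 (fun x => odd x).
Proof.
apply: (@recursive1_prim 0 (fun _ r => 1 - r)) => // [|y].
  apply: (recursive_comp2 recursive2_sub); last exact: rec_proj.
  exact: recursive_const.
by rewrite /=; case: odd.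
Qed.

Lemma recursive1_half : recursive1 half.
Proof.
apply: (@recursive1_prim 0 (fun y r => odd y + r)) => // [|y].
  apply: (recursive_comp2 recursive2_add); last exact: rec_proj.
  by apply: (recursive_comp1 recursive1_odd); apply: rec_proj.
by rewrite /= uphalf_half.
Qed.

Lemma recursive2_eq : recursive2 (fun x y => x == y).
Proof.
suff: recursive2 (fun x y => 1 - ((x - y) + (y - x))).
  by apply: recursive_ext => v; case: eqP; lia.
apply: (recursive_comp2 recursive2_sub); first exact: recursive_const.
by apply: (recursive_comp2 recursive2_add);
  apply: (recursive_comp2 recursive2_sub); apply: rec_proj.
Qed.

(** This is the step of [CodeSeq.code]: the code of [x :: s] is [npair] of the codes of x and s, so
    the same projections serve pairs and lists. Since [a < npair a b], the number z itself is a
    sufficient count of halvings to reach the odd part; [nfst] counts the even iterates on the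
    way. *)
Definition npair a b := 2 ^ a * b.*2.+1.
Definition halve_even z := if odd z then z else z./2.
Definition nsnd z := (iter z halve_even z)./2.
Definition nfst z := \sum_(i < z) ~~ odd (iter i halve_even z).

Lemma npair_gt a b : a < npair a b.
Proof. by apply: leq_trans (ltn_expl a (ltnSn 1)) _; rewrite leq_pmulr. Qed.

Lemma iter_halve_even i a b :
  iter i halve_even (npair a b) = npair (a - i) b.
Proof.
elim: i => [|i IHi] /=; first by rewrite subn0.
rewrite IHi subnS; case: (a - i) => [|k].
  by rewrite /halve_even /npair mul1n /= odd_double.
by rewrite /halve_even /npair expnS -mulnA mul2n odd_double doubleK.
Qed.

Lemma npairK1 a b : nfst (npair a b) = a.
Proof.
have le := ltnW (npair_gt a b); rewrite /nfst.
have odd_npair k : ~~ odd (npair k b) = (0 < k).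
  by case: k => [|k]; rewrite /npair ?mul1n /= ?odd_double // oddM oddX.
under eq_bigr => i _ do rewrite iter_halve_even odd_npair subn_gt0.
rewrite -(big_mkord xpredT (fun i => (i < a) : nat)) (big_cat_nat (n := a)) //=.
rewrite [X in _ + X]big_nat_cond [X in _ + X]big1 ?addn0; last first.
  by move=> i /andP[/andP[ai _] _]; rewrite ltnNge ai.
rewrite big_nat_cond (eq_bigr (fun=> 1)); last by move=> i /andP[/andP[_ ->]].
by rewrite -big_nat_cond sum_nat_const_nat subn0 muln1.
Qed.

Lemma npairK2 a b : nsnd (npair a b) = b.
Proof.
rewrite /nsnd iter_halve_even (eqP (ltnW (npair_gt a b))).
by rewrite /npair mul1n /= uphalf_double.
Qed.

Lemma recursive2_iter h : recursive1 h -> recursive2 (fun i x => iter i h x).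
Proof.
move=> hr; apply: (@recursive2_prim id (fun _ r _ => h r)) => //.
  exact: rec_proj.
by apply: (recursive_comp1 hr); apply: rec_proj.
Qed.

Lemma recursive1_halve_even : recursive1 halve_even.
Proof.
suff: recursive1 (fun z => odd z * z + (1 - odd z) * z./2).
  by apply: recursive1_ext => z; rewrite /halve_even; case: odd; lia.
apply: (recursive_comp2 recursive2_add); apply: (recursive_comp2 recursive2_mul).
- exact: recursive1_odd.
- exact: rec_proj.
- apply: (recursive_comp2 recursive2_sub); first exact: recursive_const.
  exact: recursive1_odd.
- exact: recursive1_half.
Qed.

Lemma recursive2_pair : recursive2 npair.
Proof.
apply: (recursive_comp2 recursive2_mul).
  by apply: (recursive_comp1 recursive1_exp2); apply: rec_proj.
suff: recursive1 (fun b => (b + b).+1).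
  move=> hr; apply: recursive_ext (recursive_comp1 hr (rec_proj ord_max)) => v.
  by rewrite addnn.
apply: (recursive_comp1 rec_succ).
by apply: (recursive_comp2 recursive2_add); apply: rec_proj.
Qed.

Lemma recursive1_snd : recursive1 nsnd.
Proof.
apply: (recursive_comp1 recursive1_half).
exact: recursive2_diag (recursive2_iter recursive1_halve_even).
Qed.

Lemma recursive1_fst : recursive1 nfst.
Proof.
suff hr : recursive2 (fun y z => \sum_(i < y) ~~ odd (iter i halve_even z)).
  exact: recursive2_diag hr.
apply: (@recursive2_prim (fun=> 0)
  (fun y r z => r + (1 - odd (iter y halve_even z)))) => [||x|y x].
- exact: recursive_const.
- apply: (recursive_comp2 recursive2_add); first exact: rec_proj.
  apply: (recursive_comp2 recursive2_sub); first exact: recursive_const.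
  apply: (recursive_comp1 recursive1_odd).
  apply: (recursive_comp2 (recursive2_iter recursive1_halve_even));
  exact: rec_proj.
- by rewrite big_ord0.
- by rewrite big_ord_recr /=; case: odd.
Qed.

End Recursive.

(** * Computable functions between encoded types *)

Class encodable (T : Type) := encode : T -> nat.

#[export] Instance nat_encodable : encodable nat := id.
#[export] Instance bool_encodable : encodable bool := nat_of_bool.
#[export] Instance prod_encodable (A B : Type) {_ : encodable A}
  {_ : encodable B} : encodable (A * B) := fun p => npair (encode p.1) (encode p.2).
#[export] Instance seq_encodable (A : Type) {_ : encodable A} :
  encodable (seq A) := fun s => CodeSeq.code (map encode s).

Lemma encode_cons (A : Type) {_ : encodable A} (x : A) s :
  encode (x :: s) = npair (encode x) (encode s).
Proof. by []. Qed.

Lemma size_le_encode (A : Type) {_ : encodable A} (s : seq A) :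
  size s <= encode s.
Proof.
elim: s => // x s IHs; rewrite encode_cons /npair /=.
by apply: leq_ltn_trans IHs _; rewrite -muln2; have := expn_gt0 2 (encode x); nia.
Qed.

(** Nothing is asked of g off the codes, so the encoding may fail to be onto, as that of pairs does:
    [npair] is never 0. *)
Definition computable (A B : Type) {_ : encodable A} {_ : encodable B}
  (f : A -> B) :=
  exists2 g, recursive1 g & forall x, g (encode x) = encode (f x).

Section Computable.
Context {C : Type} {eC : encodable C}.

Lemma computable_ext (A : Type) {_ : encodable A} (f g : C -> A) :
  f =1 g -> computable f -> computable g.
Proof. by move=> /funext ->. Qed.

Lemma computable_id : computable (fun c : C => c).
Proof. by exists id => //; apply: recursive1_id. Qed.

Lemma computable_const (A : Type) {_ : encodable A} (a : A) :
  computable (fun _ : C => a).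
Proof. by exists (fun=> encode a) => //; apply: recursive_const. Qed.

Lemma computable_comp (A B : Type) {_ : encodable A} {_ : encodable B}
  (f : C -> A) (h : A -> B) :
  computable h -> computable f -> computable (fun c => h (f c)).
Proof.
move=> [h' hr hE] [f' fr fE]; exists (fun x => h' (f' x)).
  exact: (recursive_comp1 hr fr).
by move=> c; rewrite fE hE.
Qed.

Lemma computable_encode (A : Type) {_ : encodable A} (f : C -> A) :
  computable f -> computable (fun c => encode (f c)).
Proof. by case=> g gr gE; exists g. Qed.

Lemma computable2 h (f g : C -> nat) :
  recursive2 h -> computable f -> computable g ->
  computable (fun c => h (f c) (g c)).
Proof.
move=> hr [f' fr fE] [g' gr gE]; exists (fun x => h (f' x) (g' x)).
  exact: (recursive_comp2 hr fr gr).
by move=> c; rewrite fE gE.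
Qed.

Section Pair.
Context {A B : Type} {eA : encodable A} {eB : encodable B}.

Lemma computable_pair (f : C -> A) (g : C -> B) :
  computable f -> computable g -> computable (fun c => (f c, g c)).
Proof.
move=> [f' fr fE] [g' gr gE]; exists (fun x => npair (f' x) (g' x)).
  exact: recursive_comp2 recursive2_pair fr gr.
by move=> c; rewrite fE gE.
Qed.

Lemma computable_fst (f : C -> A * B) :
  computable f -> computable (fun c => (f c).1).
Proof.
move=> [f' fr fE]; exists (fun x => nfst (f' x)).
  exact: recursive_comp1 recursive1_fst fr.
by move=> c; rewrite fE npairK1.
Qed.

Lemma computable_snd (f : C -> A * B) :
  computable f -> computable (fun c => (f c).2).
Proof.
move=> [f' fr fE]; exists (fun x => nsnd (f' x)).
  exact: recursive_comp1 recursive1_snd fr.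
by move=> c; rewrite fE npairK2.
Qed.

End Pair.

Lemma computable_if (A : Type) {_ : encodable A} (b : C -> bool) (f g : C -> A) :
  computable b -> computable f -> computable g ->
  computable (fun c => if b c then f c else g c).
Proof.
move=> [b' br bE] [f' fr fE] [g' gr gE].
exists (fun x => b' x * f' x + (1 - b' x) * g' x).
  apply: (recursive_comp2 recursive2_add);
    apply: (recursive_comp2 recursive2_mul) => //.
  by apply: (recursive_comp2 recursive2_sub) => //; apply: recursive_const.
move=> c; rewrite bE fE gE.
by case: (b c); rewrite /= ?mul1n ?mul0n ?addn0 ?add0n.
Qed.

Section Iteration.
Context {A B : Type} {eA : encodable A} {eB : encodable B}.

Lemma computable_iter (n : C -> nat) (b : C -> B) (h : C -> B -> B) :
  computable n -> computable b -> computable (fun p : C * B => h p.1 p.2) ->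
  computable (fun c => iter (n c) (h c) (b c)).
Proof.
move=> [n' nr nE] [b' br bE] [h' hr hE].
(* [recursive2_iter] iterates a function of one argument, so the state is the pair of the parameter
   c and the current value. *)
pose step z := npair (nfst z) (h' z).
have stepr : recursive1 step.
  by apply: (recursive_comp2 recursive2_pair) => //; apply: recursive1_fst.
exists (fun x => nsnd (iter (n' x) step (npair x (b' x)))).
  apply: (recursive_comp1 recursive1_snd).
  apply: (recursive_comp2 (recursive2_iter stepr)) => //.
  by apply: (recursive_comp2 recursive2_pair) => //; apply: rec_proj.
move=> c; rewrite nE bE -[encode (n c)]/(n c).
have -> : iter (n c) step (npair (encode c) (encode (b c))) =
          npair (encode c) (encode (iter (n c) (h c) (b c))).
  elim: (n c) => //= i ->; rewrite /step npairK1; congr (npair _ _).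
  exact: (hE (c, _)).
exact: npairK2.
Qed.

Lemma computable_case (s : C -> seq A) (b : C -> B) (h : C -> A -> seq A -> B) :
  computable s -> computable b ->
  computable (fun p : C * (A * seq A) => h p.1 p.2.1 p.2.2) ->
  computable (fun c => if s c is x :: s' then h c x s' else b c).
Proof.
move=> [s' sr sE] [b' br bE] [h' hr hE].
(* The empty list has code 0, while [x :: t] has a positive code, namely that of the pair [(x, t)];
   hence h' can be applied to the code of the list as it is. *)
exists (fun x => (s' x == 0) * b' x + (1 - (s' x == 0)) * h' (npair x (s' x))).
  have zr : recursive1 (fun x => s' x == 0).
    by apply: (recursive_comp2 recursive2_eq) => //; apply: recursive_const.
  apply: (recursive_comp2 recursive2_add);
    apply: (recursive_comp2 recursive2_mul) => //.
    by apply: (recursive_comp2 recursive2_sub) => //; apply: recursive_const.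
  apply: (recursive_comp1 hr).
  by apply: (recursive_comp2 recursive2_pair) => //; apply: rec_proj.
move=> c; rewrite sE bE; case: (s c) => [|x t].
  by rewrite /= addn0 mul1n.
rewrite encode_cons gtn_eqF ?mul0n ?add0n ?subn0 ?mul1n.
  exact: (hE (c, (x, t))).
by apply: leq_ltn_trans (npair_gt _ _).
Qed.

End Iteration.
End Computable.

Ltac computable_proj :=
  cbv beta;
  lazymatch goal with
  | |- computable (fun c => (_, _)) => apply: computable_pair; computable_proj
  | |- computable (fun c => fst _) => apply: computable_fst; computable_proj
  | |- computable (fun c => snd _) => apply: computable_snd; computable_proj
  | |- computable (fun c => c) => exact: computable_id
  | |- computable fst => exact: (computable_fst computable_id)
  | |- computable snd => exact: (computable_snd computable_id)
  | _ => idtac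
  end.

Section Fold.
Context {C A B : Type} {eC : encodable C} {eA : encodable A} {eB : encodable B}.

Lemma computable_foldl (s : C -> seq A) (b : C -> B) (h : C -> B -> A -> B) :
  computable s -> computable b ->
  computable (fun p : C * (B * A) => h p.1 p.2.1 p.2.2) ->
  computable (fun c => foldl (h c) (b c) (s c)).
Proof.
move=> sc bc hc.
pose step c (p : seq A * B) :=
  if p.1 is x :: s' then (s', h c p.2 x) else ([::], p.2).
have iterE c s0 r n : size s0 <= n ->
    (iter n (step c) (s0, r)).2 = foldl (h c) r s0.
  elim: s0 r n => [|x t IHt] r n.
    move=> _; suff -> : iter n (step c) ([::], r) = ([::], r) by [].
    by elim: n => //= n ->.
  by case: n => // n lt_tn; rewrite iterSr; apply: IHt.
(* The code of a list bounds its length and the step is stationary once the list is exhausted, so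
   the code serves as the number of iterations. *)
apply: (@computable_ext _ _ _ _
          (fun c => (iter (encode (s c)) (step c) (s c, b c)).2)) => [c|].
  exact/iterE/size_le_encode.
apply: computable_snd; apply: computable_iter; first exact: computable_encode.
  exact: computable_pair.
apply: computable_case; first by computable_proj.
  by computable_proj; exact: computable_const.
computable_proj.
apply: (computable_comp (f := fun p => (p.1.1, (p.1.2.2, p.2.1))) hc).
by computable_proj.
Qed.

End Fold.

Section Booleans.
Context {C : Type} {eC : encodable C}.
Implicit Types (f g : C -> nat) (a b : C -> bool).

Lemma computable_addn f g :
  computable f -> computable g -> computable (fun c => f c + g c).
Proof. exact: computable2 recursive2_add. Qed.

Lemma computable_subn f g :
  computable f -> computable g -> computable (fun c => f c - g c).
Proof. exact: computable2 recursive2_sub. Qed.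

Lemma computable_succn f : computable f -> computable (fun c => (f c).+1).
Proof.
by apply: (computable_comp (h := S)); exists S => //; apply: rec_succ.
Qed.

Lemma computable_predn f : computable f -> computable (fun c => (f c).-1).
Proof.
by apply: (computable_comp (h := predn)); exists predn => //; apply: recursive1_pred.
Qed.

Lemma computable_double f : computable f -> computable (fun c => (f c).*2).
Proof.
move=> fc; apply: (@computable_ext _ _ _ _ (fun c => f c + f c)) => [c|].
  exact: addnn.
exact: computable_addn.
Qed.

Lemma computable_half f : computable f -> computable (fun c => (f c)./2).
Proof.
by apply: (computable_comp (h := half)); exists half => //; apply: recursive1_half.
Qed.

Lemma computable_odd f : computable f -> computable (fun c => odd (f c)).
Proof.
by apply: (computable_comp (h := odd)); exists odd => //; apply: recursive1_odd.
Qed.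

Lemma computable_eqn f g :
  computable f -> computable g -> computable (fun c => f c == g c).
Proof.
move=> [f' fr fE] [g' gr gE]; exists (fun x => f' x == g' x).
  exact: recursive_comp2 recursive2_eq fr gr.
by move=> c; rewrite fE gE.
Qed.

Lemma computable_leq f g :
  computable f -> computable g -> computable (fun c => f c <= g c).
Proof.
move=> fc gc; apply: computable_eqn; last exact: computable_const.
exact: computable_subn.
Qed.

Lemma computable_negb a : computable a -> computable (fun c => ~~ a c).
Proof. by move=> ac; apply: computable_if ac _ _; apply: computable_const. Qed.

Lemma computable_andb a b :
  computable a -> computable b -> computable (fun c => a c && b c).
Proof. by move=> ac bc; apply: computable_if => //; apply: computable_const. Qed.

Lemma computable_implb a b :
  computable a -> computable b -> computable (fun c => a c ==> b c).
Proof. by move=> ac bc; apply: computable_if => //; apply: computable_const. Qed.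

Lemma computable_eqseq (f g : C -> seq nat) :
  computable f -> computable g -> computable (fun c => f c == g c).
Proof.
move=> fc gc; have -> : (fun c => f c == g c) =
    (fun c => encode (f c) == encode (g c)).
  apply: funext => c; rewrite (inj_eq (f := encode (T := seq nat))) //.
  by rewrite /encode /seq_encodable => u v /(can_inj CodeSeq.codeK); rewrite !map_id.
exact: computable_eqn (computable_encode fc) (computable_encode gc).
Qed.

End Booleans.

Section Sequences.
Context {C A : Type} {eC : encodable C} {eA : encodable A}.
Implicit Types s t : C -> seq A.

Lemma computable_cons (x : C -> A) s :
  computable x -> computable s -> computable (fun c => x c :: s c).
Proof.
move=> xc sc; have [g gr gE] := computable_pair xc sc.
by exists g.
Qed.

End Sequences.

Section SequenceFolds.
Context {C A : Type} {eC : encodable C} {eA : encodable A}.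
Implicit Types s t : C -> seq A.

Lemma computable_rev s : computable s -> computable (fun c => rev (s c)).
Proof.
move=> sc; pose r c := foldl (fun u x => x :: u) [::] (s c).
apply: (@computable_ext _ _ _ _ r) => [c|]; last first.
  apply: (computable_foldl (h := fun _ u x => x :: u)) => //.
    exact: computable_const.
  by apply: computable_cons; computable_proj.
rewrite /r -[RHS]cats0; elim: (s c) [::] => //= x u IHu v.
by rewrite IHu rev_cons cat_rcons.
Qed.

Lemma computable_foldr (B : Type) {_ : encodable B} s (b : C -> B)
  (h : C -> A -> B -> B) :
  computable s -> computable b ->
  computable (fun p : C * (A * B) => h p.1 p.2.1 p.2.2) ->
  computable (fun c => foldr (h c) (b c) (s c)).
Proof.
move=> sc bc hc.
apply: (@computable_ext _ _ _ _
          (fun c => foldl (fun z x => h c x z) (b c) (rev (s c)))) => [c|].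
  by rewrite foldl_rev.
apply: computable_foldl => //; first exact: computable_rev.
apply: (computable_comp (f := fun p => (p.1, (p.2.2, p.2.1))) hc).
by computable_proj.
Qed.

End SequenceFolds.

Section MoreSequences.
Context {C A : Type} {eC : encodable C} {eA : encodable A}.
Implicit Types s t : C -> seq A.

Lemma computable_size s : computable s -> computable (fun c => size (s c)).
Proof.
move=> sc; apply: (computable_foldr (h := fun _ _ n => n.+1)) => //.
  exact: computable_const.
apply: (computable_addn (f := fun=> 1)); first exact: computable_const.
by computable_proj.
Qed.

Lemma computable_cat s t :
  computable s -> computable t -> computable (fun c => s c ++ t c).
Proof.
move=> sc tc.
apply: (@computable_ext _ _ _ _ (fun c => foldr cons (t c) (s c))) => [c|].
  by elim: (s c) => //= x u ->.
by apply: computable_foldr => //; apply: computable_cons; computable_proj.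
Qed.

Lemma computable_all s (a : C -> A -> bool) :
  computable s -> computable (fun p : C * A => a p.1 p.2) ->
  computable (fun c => all (a c) (s c)).
Proof.
move=> sc ac.
apply: (computable_foldr (h := fun c x b => a c x && b)) => //.
  exact: computable_const.
apply: computable_andb; last by computable_proj.
apply: (computable_comp (f := fun p => (p.1, p.2.1)) ac).
by computable_proj.
Qed.

Lemma computable_map (B : Type) {_ : encodable B} s (h : C -> A -> B) :
  computable s -> computable (fun p : C * A => h p.1 p.2) ->
  computable (fun c => map (h c) (s c)).
Proof.
move=> sc hc.
apply: (computable_foldr (h := fun c x r => h c x :: r)) => //.
  exact: computable_const.
apply: computable_cons; last by computable_proj.
apply: (computable_comp (f := fun p => (p.1, p.2.1)) hc).
by computable_proj.
Qed.

Lemma computable_filter s (a : C -> A -> bool) :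
  computable s -> computable (fun p : C * A => a p.1 p.2) ->
  computable (fun c => filter (a c) (s c)).
Proof.
move=> sc ac.
apply: (computable_foldr (h := fun c x r => if a c x then x :: r else r)) => //.
  exact: computable_const.
apply: computable_if; last by computable_proj.
  apply: (computable_comp (f := fun p => (p.1, p.2.1)) ac).
  by computable_proj.
by apply: computable_cons; computable_proj.
Qed.

Lemma computable_behead s : computable s -> computable (fun c => behead (s c)).
Proof.
move=> sc; apply: (computable_case (h := fun _ _ u => u)) => //; last by computable_proj.
exact: computable_const.
Qed.

End MoreSequences.

Section Indexing.
Context {C A : Type} {eC : encodable C} {eA : encodable A}.

Lemma computable_nth (d : A) (s : C -> seq A) (i : C -> nat) :
  computable s -> computable i -> computable (fun c => nth d (s c) (i c)).
Proof.
move=> sc ic.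
apply: (@computable_ext _ _ _ _
   (fun c => if iter (i c) behead (s c) is x :: _ then x else d)) => [c|].
  elim: (i c) (s c) => [|n IHn] u; first by case: u.
  by rewrite iterSr IHn nth_behead.
apply: (computable_case (h := fun _ x _ => x)); last by computable_proj.
  apply: (computable_iter (h := fun=> behead)) => //.
  by apply: computable_behead; computable_proj.
exact: computable_const.
Qed.

Lemma computable_iota (m n : C -> nat) :
  computable m -> computable n -> computable (fun c => iota (m c) (n c)).
Proof.
move=> mc nc.
apply: (@computable_ext _ _ _ _ (fun c =>
  iter (n c) (fun s => rcons s (m c + size s)) [::])) => [c|].
  elim: (n c) => // k IHk; rewrite iterS IHk size_iota.
  by rewrite -cats1 -addn1 iotaD.
apply: (computable_iter (h := fun c s => rcons s (m c + size s))) => //.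
  exact: computable_const.
apply: (@computable_ext _ _ _ _
  (fun p : C * seq nat => p.2 ++ [:: m p.1 + size p.2])) => [p|].
  by rewrite cats1.
apply: computable_cat; first by computable_proj.
apply: computable_cons; last exact: computable_const.
apply: computable_addn; last by apply: computable_size; computable_proj.
by apply: (computable_comp mc); computable_proj.
Qed.

End Indexing.

Section Search.

Lemma recursive1_search c :
  recursive2 c -> (forall x, exists y, c y x = 0) ->
  exists2 r, recursive1 r & forall x, c (r x) x = 0.
Proof.
move=> cr ex_c.
have ex_cb x : exists y, c y x == 0 by have [y /eqP] := ex_c x; exists y.
pose r x := ex_minn (ex_cb x).
have rP x : c (r x) x = 0 by rewrite /r; case: ex_minnP => y /eqP.
exists r => //; apply: (rec_min cr) => [v|v y].
  by rewrite !(tnth_nth 0) /=; apply: etrans (rP _); rewrite /thead (tnth_nth 0).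
rewrite !(tnth_nth 0) /= /r; case: ex_minnP => z _ z_min lt_yz /eqP cy.
suff : z <= y by rewrite leqNgt lt_yz.
by apply: z_min; rewrite /thead (tnth_nth 0).
Qed.

(* The search runs over all codes, so both encodings must be onto. *)
Lemma computable_search (A B : Type) {eA : encodable A} {eB : encodable B}
    (dA : nat -> A) (dB : nat -> B) (a : A -> B -> bool) :
  cancel dA encode -> cancel dB encode ->
  computable (fun p : A * B => a p.1 p.2) -> (forall x, exists y, a x y) ->
  exists2 f : A -> B, computable f & forall x, a x (f x).
Proof.
move=> dAK dBK [a' ar aE] ex_a.
have [||r rr rP] := @recursive1_search (fun y x => 1 - a' (npair x y)).
- apply: (recursive_comp2 recursive2_sub); first exact: recursive_const.
  apply: (recursive_comp1 ar).
  by apply: (recursive_comp2 recursive2_pair); apply: rec_proj.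
- move=> x; have [y axy] := ex_a (dA x); exists (encode y).
  by rewrite -[X in npair X]dAK (aE (dA x, y)) axy.
exists (fun x => dB (r (encode x))).
  by exists r => // x; rewrite dBK.
move=> x; have axr : a' (npair (encode x) (r (encode x))) = a x (dB (r (encode x))).
  apply: etrans (aE (x, dB (r (encode x)))).
  by congr (a' (npair _ _)); apply/esym/dBK.
by have := rP (@encode _ eA x); rewrite axr; case: (a x _).
Qed.

End Search.

Lemma encode_seqK (A : Type) {_ : encodable A} (d : nat -> A) :
  cancel d encode -> cancel (fun x => map d (CodeSeq.decode x)) encode.
Proof.
by move=> dK x; rewrite /encode /seq_encodable mapK // CodeSeq.decodeK.
Qed.

(** * Lengths in free groups *)

Section CommonPrefix.
Variable A : eqType.
Implicit Types u v w : seq A.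

Fixpoint lcp u v := match u, v with
  | a :: u', b :: v' => if a == b then (lcp u' v').+1 else 0
  | _, _ => 0
  end.

Lemma lcpC u v : lcp u v = lcp v u.
Proof.
by elim: u v => [|a u IHu] [|b v] //=; rewrite eq_sym IHu.
Qed.

(** The ultrametric inequality: u and w agree at least as far as both agree with v. It is the source
    of the four-point condition. *)
Lemma lcp_min u v w : minn (lcp u v) (lcp v w) <= lcp u w.
Proof.
elim: u v w => [|a u IHu] [|b v] [|c w] //=; rewrite ?min0n ?minn0 //.
case: eqP => [->|_]; last by rewrite min0n.
by case: eqP => [_|_]; rewrite ?minn0 // minnSS ltnS.
Qed.

Lemma lcp_le u v : lcp u v <= size v.
Proof. by elim: u v => [|a u IHu] [|b v] //=; case: eqP => // _; apply: IHu. Qed.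

Lemma lcp_take k u v : k <= lcp u v -> take k u = take k v.
Proof.
elim: k u v => [|k IHk] [|a u] [|b v] //=; case: eqP => // -> /IHk.
by move=> ->.
Qed.

Lemma take_lcp k u v :
  k <= size u -> take k u = take k v -> k <= lcp u v.
Proof.
elim: k u v => [|k IHk] [|a u] [|b v] //= ku [-> e].
by rewrite eqxx ltnS IHk.
Qed.

End CommonPrefix.

Section FreeLength.
Variable T : choiceType.
Implicit Types (u v w : word T) (x y z : free_group T).
Local Open Scope group_scope.

Lemma reduced_catr u v : reduced (u ++ v) -> reduced v.
Proof.
case: u => [|l u] //=; rewrite /reduced /= cat_path => /andP[_].
exact: path_sorted.
Qed.

Lemma word_mul_cat u v : reduced (u ++ v) -> word_mul u v = u ++ v.
Proof.
elim: u => //= l u IHu red.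
have red' : reduced (u ++ v) by apply: (@reduced_catr [:: l]).
rewrite (IHu red'); case: (u ++ v) red => //= l' w /andP[/negbTE -> _] //.
Qed.

Lemma word_mul_cat_id u v : reduced u -> word_mul u [::] = u.
Proof. by move=> ur; rewrite word_mul_cat ?cats0. Qed.

Lemma word_inv_cons l w : word_inv (l :: w) = rcons (word_inv w) (inv_letter l).
Proof. by rewrite /word_inv /= rev_cons. Qed.

Lemma size_word_inv w : size (word_inv w) = size w.
Proof. by rewrite /word_inv size_rev size_map. Qed.

Lemma word_inv_cat u v : word_inv (u ++ v) = word_inv v ++ word_inv u.
Proof. by rewrite /word_inv map_cat rev_cat. Qed.

(* The letters cancelled in u^-1 v are those of the common prefix of u and v. *)
Lemma word_mul_lcp u v : reduced u -> reduced v ->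
  word_mul (word_inv u) v = word_inv (drop (lcp u v) u) ++ drop (lcp u v) v.
Proof.
elim: u v => [|a u IHu] [|b v] ur vr; rewrite ?cats0 //=.
  by rewrite word_mul_cat_id ?word_inv_reduced //= drop0.
case: eqP => [->|/eqP ab]; last first.
  rewrite word_mul_cat // word_inv_cons cat_rcons /reduced.
  have := word_inv_reduced ur; rewrite word_inv_cons /reduced.
  case: (word_inv u) => [|c w] /=; first by rewrite inv_letterK eq_sym ab.
  rewrite cat_path rcons_path /= => /andP[-> ->] /=.
  by rewrite inv_letterK eq_sym ab.
rewrite word_inv_cons -cats1 /word_mul foldr_cat /= inv_letterK eqxx.
by apply: IHu; [apply: (@reduced_catr [:: a]) | apply: (@reduced_catr [:: b])].
Qed.

Lemma size_word_mul u v : reduced u -> reduced v ->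
  size (word_mul (word_inv u) v) + (lcp u v).*2 = size u + size v.
Proof.
move=> ur vr; rewrite word_mul_lcp // size_cat size_word_inv !size_drop.
have le_v : lcp u v <= size v := lcp_le u v.
have le_u : lcp u v <= size u by rewrite lcpC; apply: lcp_le.
lia.
Qed.

Definition len x := size (val x).
Arguments len x%_g.
(** The Gromov product based at 1: the depth at which the paths from 1 to x and to y separate in the
    Cayley tree. *)
Definition gprod x y := lcp (val x) (val y).

Lemma len_eq0 x : (len x == 0) = (x == 1).
Proof.
by apply/eqP/eqP => [/size0nil e|-> //]; apply: val_inj.
Qed.

Lemma lenV x : len x^-1 = len x.
Proof. exact: size_word_inv. Qed.

Lemma len_mulVg x y : len (x^-1 * y) + (gprod x y).*2 = len x + len y.
Proof. exact: size_word_mul (valP x) (valP y). Qed.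

(* The four-point condition: the Cayley graph of a free group is a tree. *)
Lemma len_four_points x y z :
  len (x * y) + len (y * z) <= maxn (len x + len z) (len (x * y * z) + len y).
Proof.
(* The four points are 1, [x^-1], [y] and [y * z]; the last three have Gromov products based at the
   first. *)
have := len_mulVg x^-1 y; have := len_mulVg x^-1 (y * z).
have := len_mulVg y (y * z); rewrite mulKg !invgK lenV !mulgA => e1 e2 e3.
have min_le : minn (gprod x^-1 (y * z)) (gprod y (y * z)) <= gprod x^-1 y.
  by rewrite [gprod y _]lcpC; apply: lcp_min.
have arith (lx ly lz lxy lyz lxyz a b c : nat) :
    lz + b.*2 = ly + lyz -> lxyz + a.*2 = lx + lyz -> lxy + c.*2 = lx + ly ->
    minn a b <= c -> lxy + lyz <= maxn (lx + lz) (lxyz + ly) by lia.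
exact: arith e1 e2 e3 min_le.
Qed.

Lemma word_inv_nth l w i : i < size w ->
  nth l (word_inv w) i = inv_letter (nth l w (size w - i.+1)).
Proof.
move=> iw; rewrite /word_inv nth_rev ?size_map //.
by rewrite (nth_map l) //; lia.
Qed.

Lemma inv_letter_neq (l : T * bool) : l != inv_letter l.
Proof. by case: l => t b; rewrite /inv_letter /= xpair_eqE andbC; case: b. Qed.

(* If half of x cancelled in x * x, then its middle letter would be its own
   inverse, or its two middle letters would be inverse to each other. *)
Lemma len_sqr x : x != 1 -> len x < len (x * x).
Proof.
rewrite -len_eq0 => x0; rewrite ltnNge; apply/negP => le_sqr.
have := len_mulVg x^-1 x; rewrite invgK lenV => e.
(* The half is rounded up, so that in odd length the middle letter is among those on which x and its
   inverse agree. *)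
have arith (a b c : nat) : a + b.*2 = c + c -> a <= c -> c.+1./2 <= b by lia.
move: (arith _ _ _ e le_sqr) => {arith}.
case: x x0 {le_sqr e} => [w wr]; rewrite /len /gprod [val _]/= => w0.
move/lcp_take; rewrite [val _]/= => e.
case: w => [|l w1] in w0 wr e *; first by [].
set w := l :: w1 in wr e w0.
have mid i : i < (size w).+1./2 -> nth l w i = inv_letter (nth l w (size w - i.+1)).
  move=> lt_i; rewrite -word_inv_nth; last by lia.
  by rewrite -(nth_take l lt_i) -e nth_take.
have [od|ev] := boolP (odd (size w)).
  have := mid (size w)./2; have -> : size w - (size w)./2.+1 = (size w)./2 by lia.
  move=> h; have /eqP := h ltac:(lia); apply/negP/inv_letter_neq.
have [k Ek] : exists k, size w = k.*2.+2.
  by exists (size w)./2.-1; move: w0 ev; lia.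
have := mid k; have -> : size w - k.+1 = k.+1 by lia.
move=> h; have {}h := h ltac:(lia).
have : nth l w k.+1 != inv_letter (nth l w k).
  have /(sortedP l) := wr; apply; lia.
by rewrite h inv_letterK eqxx.
Qed.

End FreeLength.

Arguments len {T} x%_g.

(** * Nielsen moves and free families *)

Section Moves.
Variables (E : Type) (mul : E -> E -> E) (inv : E -> E) (one : E).

Definition twist (e : bool) (x : E) := if e then inv x else x.

(* The move [:: i; j; e; d] replaces s_i by s_i^(+-1) s_j^(+-1), the signs being
   given by the parities of e and d. *)
Definition nmove (s : seq E) (m : seq nat) : seq E :=
  if nth 0 m 0 == nth 0 m 1 then s else
  [seq if k == nth 0 m 0 then
         mul (twist (odd (nth 0 m 2)) (nth one s (nth 0 m 0)))
             (twist (odd (nth 0 m 3)) (nth one s (nth 0 m 1)))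
       else nth one s k | k <- iota 0 (size s)].

(** Any list of naturals is a legitimate move: nothing happens if i = j or i is out of range, and an
    entry at j out of range reads as the neutral element. Every list of moves is therefore
    invertible on tuples, and certificates need no check of their form. *)
Definition nmoves := foldl nmove.

Lemma size_nmove s m : size (nmove s m) = size s.
Proof. by rewrite /nmove; case: ifP => // _; rewrite size_map size_iota. Qed.

Lemma nth_nmove s m k : nth 0 m 0 != nth 0 m 1 -> k < size s ->
  nth one (nmove s m) k = if k == nth 0 m 0 then
         mul (twist (odd (nth 0 m 2)) (nth one s (nth 0 m 0)))
             (twist (odd (nth 0 m 3)) (nth one s (nth 0 m 1)))
       else nth one s k.
Proof.
move=> /negbTE ij ks; rewrite /nmove ij (nth_map 0) ?size_iota //.
by rewrite nth_iota.
Qed.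

End Moves.

(** The same moves act on group elements, on words and on codes of words; this transports them
    between the three levels, and is why [nmove] takes bare operations instead of a group. *)
Lemma map_nmoves (E E' : Type) (mul : E -> E -> E) (inv : E -> E) (one : E)
    (mul' : E' -> E' -> E') (inv' : E' -> E') (one' : E') (f : E -> E') s ms :
  {morph f : x y / mul x y >-> mul' x y} -> {morph f : x / inv x >-> inv' x} ->
  f one = one' ->
  map f (nmoves mul inv one s ms) = nmoves mul' inv' one' (map f s) ms.
Proof.
move=> fM fV f1; elim: ms s => //= m ms IHms s; rewrite IHms; congr (nmoves _ _ _ _ _).
have f_nth k : f (nth one s k) = nth one' (map f s) k.
  have [lt|ge] := ltnP k (size s); first by rewrite (nth_map one).
  by rewrite !nth_default ?size_map.
rewrite /nmove; case: ifP => // _; rewrite -map_comp size_map.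
apply: eq_map => k /=; case: ifP => // _; rewrite fM /twist.
by do 2!case: ifP => _; rewrite ?fV !f_nth.
Qed.

Section NielsenReduced.
Variables (E : eqType) (mul : E -> E -> E) (inv : E -> E) (one : E).
Variable sz : E -> nat.

(** Nielsen's conditions on the entries and their inverses. Absence of repetitions in [P] also
    excludes mutually inverse entries and the trivial element, which is its own inverse. In a group,
    the companion bound of [sz x] by [sz (mul x y)] is the stated bound for the inverses of y and x.
    The form is a bounded Boolean test, so that it can be evaluated on codes. *)
Definition nreduced (s : seq E) : bool :=
  let P := s ++ map inv s in
  uniq P &&
  all (fun x => all (fun y => (mul x y != one) ==> (sz y <= sz (mul x y)) &&
    all (fun z => (mul y z != one) ==>
                  (sz x + sz z < sz (mul x y) + sz (mul y z))) P) P) P.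

End NielsenReduced.

Lemma map_nreduced (E E' : eqType) (mul : E -> E -> E) (inv : E -> E) (one : E)
    (mul' : E' -> E' -> E') (inv' : E' -> E') (one' : E') (f : E -> E')
    (sz : E -> nat) (sz' : E' -> nat) (s : seq E) :
  {morph f : x y / mul x y >-> mul' x y} -> {morph f : x / inv x >-> inv' x} ->
  f one = one' -> injective f -> (forall x, sz' (f x) = sz x) ->
  nreduced mul' inv' one' sz' (map f s) = nreduced mul inv one sz s.
Proof.
move=> fM fV f1 f_inj f_sz; rewrite /nreduced.
have -> : map f s ++ map inv' (map f s) = map f (s ++ map inv s).
  by rewrite map_cat -!map_comp; congr (_ ++ _); apply: eq_map => x /=; rewrite fV.
rewrite map_inj_uniq //; congr (_ && _); rewrite all_map; apply: eq_all => x /=.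
rewrite all_map; apply: eq_all => y /=.
rewrite -fM -f1 inj_eq // !f_sz all_map; congr (_ ==> (_ && _)); apply: eq_all => z /=.
by rewrite -fM inj_eq // !f_sz.
Qed.

Section Morphisms.
Local Open Scope group_scope.
Variables (G K : groupType) (f : {multiplicative G -> K}).

Lemma multiplicative1 : f 1 = 1.
Proof. by apply: (@mulgI _ (f 1)); rewrite -gmulfM !mulg1. Qed.

Lemma multiplicativeV x : f x^-1 = (f x)^-1.
Proof.
by apply: (@mulgI _ (f x)); rewrite -gmulfM !mulgV multiplicative1.
Qed.

End Morphisms.

Section Families.
Local Open Scope group_scope.
Variable G : groupType.
Implicit Types s : seq G.

Definition spans s := forall P : G -> Prop, P 1 ->
  (forall x y, P x -> P y -> P (x / y)) -> (forall x, x \in s -> P x) ->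
  forall x, P x.

(** The existence half of the universal property, with values prescribed by position. Moves act on
    positions, so passing to the moved tuple only changes one prescribed value. *)
Definition extends s := forall (K : groupType) (c : nat -> K),
  exists phi : {multiplicative G -> K},
    forall i, (i < size s)%N -> phi (nth 1 s i) = c i.

Definition gmoves := nmoves (@mul G) (@inv G) 1.

Lemma twistgK (K : groupType) e : involutive (twist (@inv K) e).
Proof. by case: e => x //=; rewrite invgK. Qed.

Lemma extends_nmove s m :
  extends s -> extends (nmove (@mul G) (@inv G) 1 s m).
Proof.
have [e|ij] := eqVneq (nth 0 m 0) (nth 0 m 1).
  by rewrite /nmove e eqxx.
move=> s_ext K c; set i := nth 0 m 0 in ij *; set j := nth 0 m 1 in ij *.
pose cj := if (j < size s)%N then c j else 1.
(* The value at position i is found by solving the equation that the new i-th entry is sent to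
   [c i]; for j out of range, [cj] is the image of the default entry 1. *)
have [phi phiE] := s_ext K (fun k => if k == i then
  twist (@inv K) (odd (nth 0 m 2)) (c i / twist (@inv K) (odd (nth 0 m 3)) cj)
  else c k).
exists phi => k; rewrite size_nmove => lt_k; rewrite nth_nmove // -/i -/j.
case: eqP => [ki|/eqP/negbTE ki]; last by rewrite phiE // ki.
have phi_j : phi (nth 1 s j) = cj.
  rewrite /cj; case: ltnP => [lt_j|ge_j]; first by rewrite phiE // eq_sym (negbTE ij).
  by rewrite nth_default // multiplicative1.
have phi_t e x : phi (twist (@inv G) e x) = twist (@inv K) e (phi x).
  by case: e => //; apply: multiplicativeV.
have := phiE k lt_k; rewrite ki eqxx => phi_i.
by rewrite gmulfM !phi_t phi_i phi_j twistgK mulgVK.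
Qed.

Lemma spans_nmove s m :
  spans s -> spans (nmove (@mul G) (@inv G) 1 s m).
Proof.
have [e|ij] := eqVneq (nth 0 m 0) (nth 0 m 1).
  by rewrite /nmove e eqxx.
move=> s_span P P1 PF Pm; set i := nth 0 m 0 in ij *; set j := nth 0 m 1 in ij *.
have PV x : P x -> P x^-1 by move=> Px; rewrite -div1g; apply: PF.
have Pn k : (k < size s)%N -> k != i -> P (nth 1 s k).
  move=> lt_k /negbTE ki; rewrite -[nth _ _ _]/(if false then 1 else nth 1 s k) -ki.
  have -> : (if k == i then 1 else nth 1 s k) =
            nth 1 (nmove (@mul G) (@inv G) 1 s m) k.
    by rewrite nth_nmove // -/i ki.
  by apply: Pm; rewrite mem_nth // size_nmove.
have Pj : P (nth 1 s j).
  have [lt_j|ge_j] := ltnP j (size s); last by rewrite nth_default.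
  by apply: Pn; rewrite // eq_sym.
apply: s_span => // _ /(nthP 1)[k lt_k <-].
have [ki|] := eqVneq k i; last exact: Pn.
have : P (nth 1 (nmove (@mul G) (@inv G) 1 s m) k).
  by apply: Pm; rewrite mem_nth // size_nmove.
rewrite nth_nmove // -/i -/j ki eqxx.
have Pt e x : P x -> P (twist (@inv G) e x) by case: e => //; apply: PV.
move/PF => /(_ _ (Pt (odd (nth 0 m 3)) _ Pj)); rewrite mulgK.
by move=> /(Pt (odd (nth 0 m 2))); rewrite twistgK.
Qed.

Lemma extends_nmoves s ms : extends s -> extends (gmoves s ms).
Proof. by elim: ms s => //= m ms IHms s s_ext; apply: IHms; apply: extends_nmove. Qed.

Lemma spans_nmoves s ms : spans s -> spans (gmoves s ms).
Proof. by elim: ms s => //= m ms IHms s s_span; exact: IHms (spans_nmove s_span). Qed.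

Lemma spans_filter s : spans s -> spans [seq x <- s | x != 1].
Proof.
move=> s_span P P1 PF Ps; apply: s_span => // x xs.
have [->//|x1] := eqVneq x 1; by apply: Ps; rewrite mem_filter x1.
Qed.

Lemma spans_eq s (K : groupType) (f h : {multiplicative G -> K}) :
  spans s -> {in s, f =1 h} -> f =1 h.
Proof.
move=> s_span fh; apply: s_span => // [|x y fx fy]; first by rewrite !multiplicative1.
by rewrite !gmulfM !multiplicativeV fx fy.
Qed.

Lemma spans_is_basis s : spans s -> extends s -> is_basis [set` s].
Proof.
move=> s_span s_ext K f; have [phi phiE] := s_ext K (fun i => f (nth 1 s i)).
have phi_s x : x \in s -> phi x = f x by case/(nthP 1) => i lt_i <-; rewrite phiE.
exists phi; split=> // psi psiE; apply: (spans_eq s_span) => x xs.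
by rewrite phi_s // psiE.
Qed.

End Families.

Section Words.
Local Open Scope group_scope.

Lemma eval_word_cons (T : Type) (G : groupType) (f : T -> G) l w :
  eval_word f (l :: w) = eval_letter f l * eval_word f w.
Proof. by rewrite /eval_word big_cons. Qed.

Lemma eval_word_cat (T : Type) (G : groupType) (f : T -> G) u v :
  eval_word f (u ++ v) = eval_word f u * eval_word f v.
Proof. exact: big_cat. Qed.

Lemma eval_letter_inv (T : Type) (G : groupType) (f : T -> G) l :
  eval_letter f (inv_letter l) = (eval_letter f l)^-1.
Proof. by case: l => t []; rewrite /eval_letter //= invgK. Qed.

Lemma eval_word_inv (T : choiceType) (G : groupType) (f : T -> G) u :
  eval_word f (word_inv u) = (eval_word f u)^-1.
Proof.
elim: u => [|l u IHu]; first by rewrite /eval_word big_nil invg1.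
rewrite word_inv_cons -cats1 eval_word_cat IHu !eval_word_cons invgM.
by rewrite [eval_word f [::]]/eval_word big_nil mulg1 eval_letter_inv.
Qed.

Lemma multiplicative_eval_word (T : Type) (G K : groupType)
    (phi : {multiplicative G -> K}) (f : T -> G) w :
  phi (eval_word f w) = eval_word (phi \o f) w.
Proof.
elim: w => [|l w IHw]; first by rewrite /eval_word !big_nil multiplicative1.
rewrite !eval_word_cons gmulfM IHw; congr (_ * _).
by rewrite /eval_letter; case: ifP; rewrite ?multiplicativeV.
Qed.

Lemma free_lift_ext (T : choiceType) (G : groupType) (f h : T -> G) :
  f =1 h -> free_lift f =1 free_lift h.
Proof. by move=> /funext ->. Qed.

Lemma multiplicative_free_lift (T : choiceType) (G K : groupType)
    (phi : {multiplicative G -> K}) (f : T -> G) u :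
  phi (free_lift f u) = free_lift (phi \o f) u.
Proof. exact: multiplicative_eval_word. Qed.

Lemma val_eval_word_free_gen (T : choiceType) w (x : free_group T) :
  val (eval_word (@free_gen T) w * x) = word_mul w (val x).
Proof.
elim: w => [|l w IHw]; first by rewrite /eval_word big_nil mul1g.
rewrite eval_word_cons -mulgA [RHS]/= -IHw.
by case: l => t [].
Qed.

Lemma free_lift_free_gen (T : choiceType) (x : free_group T) :
  free_lift (@free_gen T) x = x.
Proof.
apply: val_inj; rewrite -[X in val X = _]mulg1.
by rewrite [LHS]val_eval_word_free_gen word_mul1 ?(valP x).
Qed.

Lemma group_closed_of (G : groupType) (P : G -> Prop) :
  P 1 -> (forall x y, P x -> P y -> P (x / y)) ->
  exists N : groupClosed G, forall x, (x \in N) = `[< P x >].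
Proof.
move=> P1 PF; pose S : {pred G} := [pred x | `[< P x >]].
have PV x : P x -> P x^-1 by move=> Px; rewrite -div1g; apply: PF.
have S1 : 1 \in S by apply/asboolP.
have SV : invg_closed S by move=> x /asboolP Px; apply/asboolP/PV.
have SM : mulg_closed S.
  move=> x y /asboolP Px /asboolP Py; apply/asboolP.
  by rewrite -[y]invgK; apply: PF => //; apply: PV.
pose N := HB.pack_for (groupClosed G) S (isMulClosed.Build G S SM)
  (isInvClosed.Build G S SV) (isMul1Closed.Build G S S1).
by exists N.
Qed.

Lemma spans_generated (G : groupType) (H : groupClosed G)
    (s : seq (subgroup_of H)) :
  (forall x, x \in H -> x \in generated [set` map val s]) -> spans s.
Proof.
move=> Hs P P1 PF Ps x.
pose Q y := exists2 z : subgroup_of H, val z = y & P z.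
have [||N NE] := @group_closed_of _ Q.
- by exists 1.
- by move=> _ _ [z <- Pz] [t <- Pt]; exists (z / t); [|apply: PF].
have /asboolP/(_ N) := Hs _ (valP x).
rewrite NE => h.
have /h/asboolP[z /val_inj zx Pz] : forall t, [set` map val s] t -> t \in N.
  move=> _ /mapP[z zs ->]; rewrite NE; apply/asboolP.
  by exists z => //; apply: Ps.
by rewrite -zx.
Qed.

End Words.

(** * Nielsen reduced tuples are free, and the kernel of a map onto such a tuple *)

Section FreeFamilies.
Local Open Scope group_scope.
Variable T : choiceType.
Implicit Types (s : seq (free_group T)).

Definition nielsen_reduced s := nreduced (@mul (free_group T)) (@inv _) 1 (@len T) s.

(* Each product x_1 (x_2 ... x_k) is at least as long as x_2 ... x_k: by the
   four-point condition, the conditions on consecutive triples propagate. *)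
Lemma prod_neq1 (P : seq (free_group T)) :
  (forall x, x \in P -> x != 1) ->
  (forall x y, x \in P -> y \in P -> x * y != 1 ->
     (len y <= len (x * y))%N) ->
  (forall x y z, x \in P -> y \in P -> z \in P -> x * y != 1 -> y * z != 1 ->
     (len x + len z < len (x * y) + len (y * z))%N) ->
  forall x w, {subset x :: w <= P} -> sorted (fun x y => x * y != 1) (x :: w) ->
  x * \prod_(y <- w) y != 1.
Proof.
move=> P1 N1 N2 x w wP w_red.
(* The induction carries a stronger bound: left multiplication by x lengthens the product [y * q] at
   least as much as it lengthens y. Combined with the condition on the triple, this bound for the
   tail rules out the first term of the maximum in the four-point inequality. *)
suff : (0 < len (x * \prod_(y <- w) y))%N /\
        (forall y w', w = y :: w' -> let q := \prod_(z <- w') z in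
        (len (y * q) + len (x * y) <= len (x * (y * q)) + len y)%N).
  by case=> + _; rewrite lt0n len_eq0.
elim: w x wP w_red => [|y w IHw] x wP w_red.
  by rewrite big_nil mulg1 lt0n len_eq0 P1 ?wP ?mem_head.
have xP : x \in P by apply: wP; rewrite mem_head.
have yP : y \in P by apply: wP; rewrite !inE eqxx orbT.
have [xy yw] := andP w_red.
have wP' : {subset y :: w <= P} by move=> z zw; apply: wP; rewrite inE zw orbT.
have [q_gt0 IH] := IHw y wP' yw.
rewrite big_cons; set q := \prod_(z <- w) z in q_gt0 IH *.
have step : (len (y * q) + len (x * y) <= len (x * (y * q)) + len y)%N.
  case: w => [|z w] in wP' yw q q_gt0 IH IHw wP w_red *.
    by rewrite /q big_nil !mulg1 addnC.
  have zP : z \in P by apply: wP'; rewrite !inE eqxx orbT.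
  have [yz _] := andP yw.
  have := IH z w erefl; rewrite [\prod_(z <- _) _]big_cons in q q_gt0 IH *.
  have := N2 x y z xP yP zP xy yz.
  have := len_four_points x y q; rewrite -mulgA /q.
  set q' := \prod_(z0 <- w) z0.
  have arith (lxy lyq lx lq lxyq ly lz lyz : nat) :
    (lxy + lyq <= maxn (lx + lq) (lxyq + ly) -> lx + lz < lxy + lyz ->
     lq + lyz <= lyq + lz -> lyq + lxy <= lxyq + ly)%N by lia.
  exact: arith.
split; last by move=> _ _ [<- <-].
have := N1 x y xP yP xy.
have arith (lyq lxy lxyq ly : nat) : (lyq + lxy <= lxyq + ly -> 0 < lyq ->
  ly <= lxy -> 0 < lxyq)%N by lia.
exact: arith step q_gt0.
Qed.

(** Distinct signed letters have distinct values in the tuple and its inverses, so a nonempty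
    reduced word becomes a product without adjacent inverse factors, which [prod_neq1] shows to be
    nontrivial. *)
Lemma nielsen_reduced_free s (u : free_group 'I_(size s)) :
  nielsen_reduced s -> free_lift (fun i : 'I_(size s) => nth 1 s i) u = 1 ->
  u = 1.
Proof.
move=> s_red; set f := fun i : 'I_(size s) => nth 1 s i; set P := s ++ map (@inv _) s.
have [P_uniq /allP PP] := andP s_red; rewrite -/P in P_uniq PP.
have P1 x : x \in P -> x != 1.
  move=> xP; apply/eqP => x1.
  move: P_uniq; rewrite cat_uniq => /and3P[_ /hasP[]]; exists 1.
    move: xP; rewrite x1 mem_cat => /orP[|//].
    by move/(map_f (@inv _)); rewrite invg1.
  move: xP; rewrite x1 mem_cat => /orP[//|/mapP[y ys]].
  by move/(congr1 (@inv _)); rewrite invg1 invgK => ->.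
have fP l : eval_letter f l \in P.
  rewrite /eval_letter mem_cat; case: ifP => _; apply/orP; [right|left].
    by apply: map_f; apply: mem_nth.
  exact: mem_nth.
have f_inj : injective (eval_letter f).
  move=> [i a] [j b]; rewrite /eval_letter /=.
  (* A signed letter is read as a position in P: k for the k-th entry, [size s + k] for its inverse.
     As P has no repetitions, the value determines the position. *)
  have E (k : 'I_(size s)) c : (if c then (f k)^-1 else f k) =
      nth 1 P (if c then size s + k else k)%N.
    rewrite nth_cat; case: c; last by rewrite ltn_ord.
    by rewrite ltnNge leq_addr /= addKn (nth_map 1).
  have lt (k : 'I_(size s)) (c : bool) : ((if c then size s + k else k) < size P)%N.
    rewrite size_cat size_map; case: c; first by rewrite ltn_add2l ltn_ord.
    by rewrite ltn_addr ?ltn_ord.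
  rewrite !E => /eqP; rewrite (nth_uniq 1 (lt _ _) (lt _ _) P_uniq) => /eqP.
  have := ltn_ord i; have := ltn_ord j.
  case: a b => [] [] ji ii e; first by congr (_, _); apply: val_inj; move: e => /addnI.
  - by move: ji; rewrite -e ltnNge leq_addr.
  - by move: ii; rewrite e ltnNge leq_addr.
  - by congr (_, _); apply: val_inj.
case: u => [[|l w] wr] u1; first exact: val_inj.
have := @prod_neq1 P P1 _ _ (eval_letter f l) (map (eval_letter f) w).
rewrite big_map; move: u1; rewrite /free_lift /= eval_word_cons => ->.
case/(_ _ _ _ _)/eqP => //.
- move=> x y xP yP xy; have /allP/(_ y yP) := PP x xP.
  by rewrite xy => /andP[].
- move=> x y z xP yP zP xy yz; have /allP/(_ y yP) := PP x xP.
  by rewrite xy => /andP[_ /allP/(_ z zP)]; rewrite yz.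
- by move=> _ /(@mapP _ _ (eval_letter f) (l :: w))[l' _ ->].
rewrite path_map; apply: sub_path wr => l1 l2 /=.
by apply: contra; rewrite mulg_eq1 -eval_letter_inv => /eqP/f_inj ->; rewrite inv_letterK.
Qed.

Lemma free_lift_div (I : choiceType) (G : groupType) (f : I -> G) u v :
  free_lift f (u / v) = free_lift f u / free_lift f v.
Proof. by rewrite gmulfM multiplicativeV. Qed.

Lemma free_lift1 (I : choiceType) (G : groupType) (f : I -> G) :
  free_lift f 1 = 1.
Proof. exact: multiplicative1. Qed.

Lemma free_lift_surj (G : groupType) (s : seq G) :
  spans s -> forall x, exists u, free_lift (fun i : 'I_(size s) => nth 1 s i) u = x.
Proof.
move=> s_span; apply: s_span; first by exists 1; apply: free_lift1.
  by move=> _ _ [u <-] [v <-]; exists (u / v); rewrite free_lift_div.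
move=> _ /(nthP 1)[i lt_i <-]; exists (free_gen (Ordinal lt_i)).
exact: free_lift_gen.
Qed.

(** The canonical map from the free group on the positions of s is onto by [spans] and injective
    because the tuple is Nielsen reduced. Its inverse, followed by the lift of c, is the required
    homomorphism. *)
Lemma nielsen_reduced_extends (H : groupClosed (free_group T))
    (s : seq (subgroup_of H)) :
  spans s -> nielsen_reduced (map val s) -> extends s.
Proof.
move=> s_span s_red K c.
set f := fun i : 'I_(size s) => nth 1 s i.
have inj u v : free_lift f u = free_lift f v -> u = v.
  suff ker1 w : free_lift f w = 1 -> w = 1.
    move=> e; apply: divg1_eq; apply: ker1.
    by rewrite free_lift_div e mulgV.
  move=> /(congr1 val); rewrite multiplicative_free_lift => w1.
  have := @nielsen_reduced_free (map val s); rewrite size_map => h.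
  apply: (h _ s_red); rewrite -[RHS]w1; apply: free_lift_ext => i /=.
  by rewrite (nth_map 1).
have [g gK] := choice (free_lift_surj s_span).
pose theta (x : subgroup_of H) : K := free_lift (fun i : 'I_(size s) => c i) (g x).
have thetaM : {morph theta : x y / x * y}.
  move=> x y; rewrite /theta -free_liftM; congr (free_lift _ _).
  by apply: inj; rewrite free_liftM !gK.
pose thetaP := isMultiplicative.Build (subgroup_of H) K theta thetaM.
exists (HB.pack_for {multiplicative subgroup_of H -> K} theta thetaP).
move=> i lt_i; rewrite -[LHS]/(theta (nth 1 s i)) /theta.
have -> : g (nth 1 s i) = free_gen (Ordinal lt_i).
  by apply: inj; rewrite gK free_lift_gen.
exact: free_lift_gen.
Qed.

(* Let rho send the entries of s in the kernel to 1 and fix the others. Then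
   y^-1 rho(y) lies in the normal closure of the former, while rho(y) lies in the
   subgroup generated by the latter, on which phi is injective. *)
Lemma normal_closure_kernel (G : groupType) (s : seq G)
    (phi : {multiplicative G -> free_group T}) :
  spans s -> extends s -> nielsen_reduced (map phi [seq x <- s | phi x != 1]) ->
  normal_closure [set` [seq x <- s | phi x == 1]] = kernel phi.
Proof.
move=> s_span s_ext red; apply/seteqP; split=> y /=.
  have [||N NE] := @group_closed_of _ (fun x => phi x = 1).
  - exact: multiplicative1.
  - by move=> x z x1 z1; rewrite gmulfM multiplicativeV x1 z1 mulgV.
  move=> /(_ N); rewrite NE => h; apply/asboolP/h.
    move=> x z; rewrite !NE => /asboolP x1; apply/asboolP.
    by rewrite /conjg !gmulfM x1 mul1g -gmulfM mulVg multiplicative1.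
  by move=> x; rewrite /= mem_filter NE => /andP[/eqP x1 _]; apply/asboolP.
rewrite /kernel /= => y1 N N_norm N_s.
set d := [seq x <- s | phi x != 1] in red.
have [rho rhoE] := s_ext G (fun i => if phi (nth 1 s i) == 1 then 1 else nth 1 s i).
have rho_s x : x \in s -> rho x = if phi x == 1 then 1 else x.
  by move=> /(nthP 1)[i lt_i <-]; apply: rhoE.
have rhoN : forall x, x^-1 * rho x \in N.
  apply: s_span => [|x z xN zN|x xs]; first by rewrite multiplicative1 mulVg gpred1.
    rewrite gmulfM multiplicativeV invgF.
    have -> : z / x * (rho x / rho z) =
        (x^-1 * rho x) ^ z^-1 / (z^-1 * rho z) ^ z^-1.
      by rewrite !conjgE !invgK -!mulgA mulVKg invgM invgK mulKg.
    by apply: gpredF; apply: N_norm.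
  rewrite rho_s //; case: eqP => [x1|_]; last by rewrite mulVg gpred1.
  by rewrite mulg1 gpredV; apply: N_s; rewrite /= mem_filter x1 eqxx.
have rho_d : forall x, exists u, free_lift (fun i : 'I_(size d) => nth 1 d i) u = rho x.
  apply: s_span; first by exists 1; rewrite free_lift1 multiplicative1.
    move=> x z [u ux] [v vz]; exists (u / v).
    by rewrite free_lift_div ux vz gmulfM multiplicativeV.
  move=> x xs; rewrite rho_s //; case: eqP => [_|/eqP x1].
    by exists 1; rewrite free_lift1.
  have : x \in d by rewrite mem_filter x1.
  case/(nthP 1) => i lt_i <-; exists (free_gen (Ordinal lt_i)).
  exact: free_lift_gen.
have phi_rho : phi \o rho =1 phi.
  apply: (spans_eq s_span) => x xs /=; rewrite rho_s //.
  by case: eqP => [->|//]; rewrite multiplicative1.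
have rho_y : rho y = 1.
  have [u uE] := rho_d y; rewrite -uE.
  have : phi (rho y) = 1 by rewrite -y1 -[RHS]phi_rho.
  rewrite -uE multiplicative_free_lift => u1.
  have := @nielsen_reduced_free (map phi d); rewrite size_map => h.
  rewrite (h u red) ?free_lift1 // -[RHS]u1; apply: free_lift_ext => i /=.
  by rewrite (nth_map 1).
by have := rhoN y; rewrite rho_y mulg1 gpredV.
Qed.

End FreeFamilies.

(** * Nielsen reduction *)

Section LetterCodes.
Variables (T : choiceType) (c : T -> nat).

Definition code_letter (l : T * bool) := (c l.1).*2 + l.2.

Lemma odd_code_letter l : odd (code_letter l) = l.2.
Proof. by rewrite oddD odd_double oddb. Qed.

Lemma half_code_letter l : (code_letter l)./2 = c l.1.
Proof. by rewrite /code_letter addnC half_bit_double. Qed.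

Lemma code_letter_inj : injective c -> injective code_letter.
Proof.
move=> c_inj [t a] [t' b] e.
have := congr1 odd e; rewrite !odd_code_letter /= => ->.
by have := congr1 half e; rewrite !half_code_letter /= => /c_inj ->.
Qed.

End LetterCodes.

Section NielsenReduction.
Variable n : nat.
Implicit Types (u v w : word 'I_n) (x y z : 'F n) (s : seq 'F n).
Local Open Scope group_scope.

Local Notation letter_rank := (code_letter (@nat_of_ord n)).
Local Notation base := n.*2.+1.

(** The word read as a numeral whose digits are the letter codes. These are below 2n, so on words of
    equal length the rank is injective and lexicographic; the extra unit in the base keeps it
    positive when n = 0. *)
Fixpoint word_rank w : nat :=
  if w is l :: w' then (letter_rank l * base ^ size w' + word_rank w')%N else 0%N.

Lemma letter_rank_lt l : (letter_rank l < base)%N.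
Proof. by case: l => i b; rewrite /code_letter /=; have := ltn_ord i; case: b; lia. Qed.

Lemma word_rank_lt w : (word_rank w < base ^ size w)%N.
Proof.
elim: w => //= l w IHw; rewrite expnS.
have := letter_rank_lt l; move: (letter_rank l) (word_rank w) (base ^ _)%N IHw.
move=> a b c bc ac; have : (a.+1 * c <= base * c)%N by rewrite leq_mul2r ac orbT.
by rewrite mulSn; lia.
Qed.

Lemma word_rank_cat u v :
  word_rank (u ++ v) = (word_rank u * base ^ size v + word_rank v)%N.
Proof.
elim: u => //= l u ->; rewrite size_cat expnD; lia.
Qed.

Lemma word_rank_inj u v : size u = size v -> word_rank u = word_rank v -> u = v.
Proof.
elim: u v => [|l u IHu] [|l' v] //= [e].
have := word_rank_lt u; have := word_rank_lt v; rewrite -e => vb ub eq_rank.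
have B0 : (0 < base ^ size u)%N by rewrite expn_gt0.
have /(code_letter_inj val_inj) -> : letter_rank l = letter_rank l'.
  have := congr1 (fun k => k %/ base ^ size u)%N eq_rank.
  by rewrite /= !divnMDl // !divn_small // !addn0.
congr (_ :: _); apply: IHu => //.
have := congr1 (fun k => k %% base ^ size u)%N eq_rank.
by rewrite /= !modnMDl !modn_small.
Qed.

Definition half_rank x := word_rank (take (len x)./2 (val x)).

(* Nielsen's tie-breaking order on elements of the same length. *)
Definition weight x := (half_rank x + half_rank x^-1)%N.

Arguments weight x%_g.

Lemma weightV x : weight x^-1 = weight x.
Proof. by rewrite /weight invgK addnC. Qed.

Lemma word_inv_drop (T : choiceType) k (w : word T) :
  word_inv (drop k w) = take (size w - k) (word_inv w).
Proof.
rewrite -{3}[w](cat_take_drop k) word_inv_cat take_size_cat //.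
by rewrite size_word_inv size_drop.
Qed.

(* Here y = p q^-1 and z = q c with p, q of equal length, so that y z = p c. *)
Lemma weight_mul h y z :
  len y = h.*2 -> gprod y^-1 z = h -> (len y <= len z)%N ->
  (weight z <= weight (y * z))%N ->
  (word_rank (take h (val y^-1)) <= word_rank (take h (val y)))%N.
Proof.
move=> yh yzh yz.
have take_q : take h (val y^-1) = take h (val z) by apply: lcp_take; rewrite -yzh.
have mulE : val (y * z) = take h (val y) ++ drop h (val z).
  have := word_mul_lcp (valP y^-1) (valP z); rewrite -/(gprod y^-1 z) yzh.
  rewrite !word_inv_drop size_word_inv !word_invK.
  have -> : (size (\val y) - h = h)%N by move: yh; rewrite /len; lia.
  by move=> <-.
have len_yz : len (y * z) = len z.
  have := len_mulVg y^-1 z; rewrite invgK lenV yzh yh.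
  have arith (a b c : nat) : (a + b.*2 = b.*2 + c -> a = c)%N by lia.
  exact: arith.
have zE : val z = take h (val z) ++ drop h (val z) by rewrite cat_take_drop.
have hz : (h <= (len z)./2)%N by move: yz; rewrite yh; lia.
have sz_p : size (take h (val y)) = h.
  by rewrite size_take_min; move: yh; rewrite /len; lia.
have sz_q : size (take h (val z)) = h.
  by rewrite size_take_min; move: hz; rewrite /len; lia.
rewrite /weight /half_rank !lenV len_yz.
(* Since h is at most half the length of z, the words of [y * z] and z have the same final half, so
   their inverses have the same initial half. *)
have -> : take (len z)./2 (val (y * z)^-1) = take (len z)./2 (val z^-1).
  rewrite -[val (y * z)^-1]/(word_inv (val (y * z))) -[val z^-1]/(word_inv (val z)).
  rewrite mulE [in RHS]zE !word_inv_cat.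
  rewrite !takel_cat ?size_word_inv ?size_drop //; rewrite -/(len z); lia.
rewrite leq_add2r mulE [in take _ (val z)]zE !take_cat sz_p sz_q.
rewrite ltnNge hz /= !word_rank_cat take_q leq_add2r leq_pmul2r //.
by rewrite expn_gt0.
Qed.

Definition total_length s := (\sum_(x <- s) len x)%N.
Definition total_weight s := (\sum_(x <- s) weight x)%N.

Definition minimal s := forall ms,
  (total_length s < total_length (gmoves s ms))%N \/
  total_length s = total_length (gmoves s ms) /\
  (total_weight s <= total_weight (gmoves s ms))%N.

Lemma exists_minimal s : exists ms, minimal (gmoves s ms).
Proof.
have gmoves_cat ms ms' : gmoves (gmoves s ms) ms' = gmoves s (ms ++ ms').
  by rewrite /gmoves /nmoves foldl_cat.
have ex_l : exists l, `[< exists ms, total_length (gmoves s ms) = l >].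
  by exists (total_length s); apply/asboolP; exists [::].
have [l /asboolP[ms0 l0] l_min] := ex_minnP ex_l.
have ex_w : exists k, `[< exists2 ms, total_length (gmoves s ms) = l &
                                      total_weight (gmoves s ms) = k >].
  by exists (total_weight (gmoves s ms0)); apply/asboolP; exists ms0.
have [k /asboolP[ms ml mk] k_min] := ex_minnP ex_w.
exists ms => ms'; rewrite gmoves_cat ml mk.
have : (l <= total_length (gmoves s (ms ++ ms')))%N.
  by apply: l_min; apply/asboolP; exists (ms ++ ms').
rewrite leq_eqVlt => /orP[/eqP e|]; [right|by left].
by split=> //; apply: k_min; apply/asboolP; exists (ms ++ ms').
Qed.

Local Notation "s `_ i" := (nth (1 : 'F n)%g s i) : group_scope.
Local Notation tw := (twist (@inv 'F n)).

(** Only the i-th summand changes; the identity is written with sums on both sides because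
    subtraction of naturals truncates. *)
Lemma sum_nmove (F : 'F n -> nat) s m (i := nth 0%N m 0) (j := nth 0%N m 1) :
  i != j -> (i < size s)%N ->
  (\sum_(x <- nmove (@mul _) (@inv _) 1%g s m) F x + F (s`_i)%g =
   \sum_(x <- s) F x +
   F (tw (odd (nth 0%N m 2)) s`_i * tw (odd (nth 0%N m 3)) s`_j)%g)%N.
Proof.
move=> ij lt_i.
rewrite (big_nth 1) [in RHS](big_nth 1) size_nmove !big_mkord.
rewrite (bigD1 (Ordinal lt_i)) // [in RHS](bigD1 (Ordinal lt_i)) //=.
rewrite (eq_bigr (fun k : 'I_(size s) => F (nth 1%g s k))) => [|k ki].
  rewrite nth_nmove // eqxx addnAC [RHS]addnAC; congr (_ + _)%N.
  exact: addnC.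
by rewrite nth_nmove // ifN.
Qed.

Lemma lenT e x : len (tw e x) = len x.
Proof. by case: e; rewrite ?lenV. Qed.

Lemma weightT e x : weight (tw e x) = weight x.
Proof. by case: e; rewrite ?weightV. Qed.

Lemma minimal_mul s i j e d : minimal s ->
  (i < size s)%N -> i != j ->
  let x := tw e s`_i in
  let y := tw d s`_j in
  (len x < len (x * y) \/ len x = len (x * y) /\ weight x <= weight (x * y))%N.
Proof.
move=> s_min lt_i ij x y.
pose m := [:: i; j; e : nat; d : nat].
have := sum_nmove len (s := s) (m := m) ij lt_i.
have := sum_nmove weight (s := s) (m := m) ij lt_i.
rewrite /m /= !oddb -/x -/y -(lenT e) -(weightT e) -/x.
have := s_min [:: m]; rewrite /total_length /total_weight /gmoves /nmoves /=.
have arith (l l' lx lxy w w' wx wxy : nat) :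
  (l < l' \/ l = l' /\ w <= w' -> w' + wx = w + wxy -> l' + lx = l + lxy ->
   lx < lxy \/ lx = lxy /\ wx <= wxy)%N by lia.
exact: arith.
Qed.

(** Minimal length gives everything but the strict inequality for triples x, y, z. If that fails,
    then y = p q^-1 with p and q of equal length, p cancelling against x and q^-1 against z. Minimal
    weight, applied to [y * z] against z and to [x * y] against x, bounds the ranks of p and q by
    each other, so p = q and y would be trivial. *)
Lemma minimal_reduced s : minimal s -> nielsen_reduced [seq x <- s | x != 1].
Proof.
move=> s_min; set s1 := [seq x <- s | x != 1].
(* The position is recorded because a move combines entries at different positions only; two factors
   from the same position are equal or inverse, and squares are settled by [len_sqr]. *)
pose entry x i := [/\ (i < size s)%N, x != 1 &
  exists e, x = tw e s`_i].
have s1P x : x \in s1 -> exists i, entry x i.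
  rewrite mem_filter => /andP[x1 /(nthP 1)[i lt_i xE]]; exists i.
  by split=> //; exists false.
have entryV x i : entry x i -> entry x^-1 i.
  case=> lt_i x1 [e xE]; split=> //; first by rewrite invg_eq1.
  by exists (~~ e); rewrite xE; case: e {xE}; rewrite /= ?invgK.
have PP x : x \in s1 ++ map (@inv _) s1 -> exists i, entry x i.
  rewrite mem_cat => /orP[/s1P//|/mapP[y /s1P[i yi] ->]].
  by exists i; apply: entryV.
have mul_r x i y j : entry x i -> entry y j -> i != j ->
    (len x < len (x * y) \/ len x = len (x * y) /\ weight x <= weight (x * y))%N.
  case=> lt_i _ [e ->] [_ _ [d ->]]; exact: minimal_mul.
have mul_l x i y j : entry x i -> entry y j -> i != j ->
    (len y < len (x * y) \/ len y = len (x * y) /\ weight y <= weight (x * y))%N.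
  move=> /entryV xi /entryV yj ij; have := mul_r _ _ _ _ yj xi.
  by rewrite -invgM !lenV !weightV eq_sym; apply.
have same x y i : entry x i -> entry y i -> x * y != 1 -> x = y.
  case=> _ _ [e ->] [_ _ [d ->]].
  by case: e d => [] [] //=; rewrite ?mulgV ?mulVg ?eqxx.
have no_inv x i y j : entry x i -> entry y j -> i != j -> x * y != 1.
  move=> xi yj ij; apply/eqP => xy1; have [_ x1 _] := xi.
  have := mul_r _ _ _ _ xi yj ij; rewrite xy1.
  have := x1; rewrite -len_eq0 -[len 1]/0%N; lia.
have N1 x y i j : entry x i -> entry y j -> x * y != 1 ->
    (len x <= len (x * y) /\ len y <= len (x * y))%N.
  move=> xi yj xy1; have [ij|ij] := eqVneq i j.
    have [_ x1 _] := xi; rewrite -ij in yj.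
    by rewrite -(same x y i) // ltnW ?len_sqr.
  by have := mul_r _ _ _ _ xi yj ij; have := mul_l _ _ _ _ xi yj ij; lia.
have sqr_neq1 x : x != 1 -> x * x != 1.
  by move=> /len_sqr; apply: contraTneq => ->; rewrite ltn0.
have s1_uniq : uniq s1.
  rewrite uniq_pairwise.
  have /pairwise_filter : pairwise (fun x y => (x != 1) ==> (x != y)) s.
    apply/(pairwiseP 1) => i j lt_i lt_j ij; apply/implyP => x1.
    apply/eqP => xy.
    have xi : entry s`_i i by split=> //; exists false.
    have yj : entry (s`_j)^-1 j.
      by split=> //; [rewrite invg_eq1 -xy|exists true].
    have := no_inv _ _ _ _ xi yj; rewrite ltn_eqF // => /(_ isT).
    by rewrite xy mulgV eqxx.
  move=> /(_ (fun x => x != 1)).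
  apply: (sub_in_pairwise (P := fun x => x != 1)); last exact: filter_all.
  by move=> x y x1 _ /=; rewrite [x != 1]x1.
apply/andP; split.
  rewrite cat_uniq s1_uniq (map_inj_uniq invg_inj) s1_uniq andbT /=.
  apply/hasPn => _ /mapP[y ys ->]; apply/negP => xs.
  have [_ [_ y1 _]] := s1P _ ys; have := sqr_neq1 y y1.
  move: xs ys; rewrite !mem_filter => /andP[_ /(nthP 1)[i' lt_i' i'E]].
  move=> /andP[_ /(nthP 1)[j' lt_j' j'E]].
  have [e|ne] := eqVneq i' j'; first by rewrite -{1}j'E -e i'E mulVg eqxx.
  have xi' : entry y^-1 i' by split; rewrite ?invg_eq1 //; exists false.
  have yj' : entry y j' by split=> //; exists false.
  by have := no_inv _ _ _ _ xi' yj' ne; rewrite mulVg eqxx.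
apply/allP => x /PP[i xi]; apply/allP => y /PP[j yj]; apply/implyP => xy1.
have [xle yle] := N1 _ _ _ _ xi yj xy1.
rewrite yle /=; apply/allP => z /PP[k zk]; apply/implyP => yz1.
have [yle' zle] := N1 _ _ _ _ yj zk yz1.
rewrite ltnNge; apply/negP => le.
have y1 : y != 1 by have [] := yj.
have [xy_len yz_len] : len (x * y) = len x /\ len (y * z) = len z.
  have arith (a b c d : nat) :
    (a + b <= c + d -> c <= a -> d <= b -> a = c /\ b = d)%N by lia.
  exact: arith le xle zle.
have ij : i != j.
  apply/eqP => e; rewrite e in xi; have := len_sqr y1; move: xy_len.
  by rewrite (same _ _ _ xi yj xy1) => ->; rewrite ltnn.
have jk : j != k.
  apply/eqP => e; rewrite -e in zk; have := len_sqr y1; move: yz_len.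
  by rewrite -(same _ _ _ yj zk yz1) => ->; rewrite ltnn.
have wx : (weight x <= weight (x * y))%N.
  by case: (mul_r _ _ _ _ xi yj ij) => [|[]//]; rewrite xy_len ltnn.
have wz : (weight z <= weight (y * z))%N.
  by case: (mul_l _ _ _ _ yj zk jk) => [|[]//]; rewrite yz_len ltnn.
(* The equalities of lengths force exactly half of y to cancel against z, and likewise against x. *)
pose h := gprod y^-1 z.
have hz : len y = h.*2.
  have := len_mulVg y^-1 z; rewrite invgK lenV yz_len.
  have arith (a b c : nat) : (a + b.*2 = c + a -> c = b.*2)%N by lia.
  exact: arith.
have hx : gprod y x^-1 = h.
  have := len_mulVg y x^-1; rewrite -invgM !lenV xy_len hz.
  have arith (a b c : nat) : (a + b.*2 = c.*2 + a -> b = c)%N by lia.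
  exact: arith.
have le1 := @weight_mul h y z hz erefl.
have le2 := @weight_mul h y^-1 x^-1.
have e : take h (val y^-1) = take h (val y).
  apply: word_rank_inj.
    by rewrite !size_take_min -/(len y) -/(len y^-1) lenV.
  apply/eqP; rewrite eqn_leq le1 ?(leq_trans yle') ?yz_len //.
  move: le2; rewrite !invgK lenV -invgM !weightV lenV.
  by apply => //; rewrite (leq_trans yle) ?xy_len.
have : (h <= gprod y^-1 y)%N.
  by apply: take_lcp e; rewrite -/(len y^-1) lenV hz -addnn leq_addr.
have := len_mulVg y^-1 y; have := len_sqr y1; rewrite invgK lenV hz.
have arith (a b c : nat) :
  (b.*2 < a -> a + c.*2 = b.*2 + b.*2 -> b <= c -> False)%N by lia.
exact: arith.
Qed.

Lemma nielsen_reduction s :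
  exists ms, nielsen_reduced [seq x <- gmoves s ms | x != 1].
Proof.
have [ms ms_min] := exists_minimal s.
by exists ms; apply: minimal_reduced.
Qed.

End NielsenReduction.

(** * The kernel *)

Section Ideal.
Local Open Scope group_scope.
Variables (n : nat) (H : groupClosed 'F n).
Implicit Types (b : seq (subgroup_of H)) (g : 'F n).

Definition adjoin_family b : seq (adjoin H) :=
  adjoin_x H :: map (fprod_inl (free_group unit)) b.

Lemma spans_adjoin b : spans b -> spans (adjoin_family b).
Proof.
move=> b_span P P1 PF Ps.
have PM x y : P x -> P y -> P (x * y).
  move=> Px Py; rewrite -[y]invgK; apply: (PF) => //.
  by rewrite -div1g; apply: PF.
elim/fprod_piW => u; elim: u => [|c u IHu]; first exact: P1.
suff Pc : P (fprod_pi [:: c]).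
  by have := PM _ _ Pc IHu; rewrite [X in P X]fprod_mulE.
case: c => [h|z].
  rewrite -[fprod_pi _]/(fprod_inl (free_group unit) h); move: h.
  apply: b_span => [|h h' Ph Ph'|h hb].
  - by rewrite multiplicative1.
  - by rewrite gmulfM multiplicativeV; apply: PF.
  - by apply: Ps; rewrite inE map_f ?orbT.
rewrite -[fprod_pi _]/(fprod_inr (subgroup_of H) z).
rewrite -[z]free_lift_free_gen multiplicative_free_lift /free_lift.
elim: (val z) => [|l w IHw]; first by rewrite /eval_word big_nil.
rewrite eval_word_cons; apply: PM => //.
have Px : P (adjoin_x H) by apply: Ps; rewrite mem_head.
rewrite /eval_letter /=; by case: l => [[] []] //=; rewrite -div1g; apply: (PF).
Qed.

Lemma extends_adjoin b : extends b -> extends (adjoin_family b).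
Proof.
move=> b_ext K c; have [theta thetaE] := b_ext K (fun i => c i.+1).
exists (fprod_lift theta (free_lift (fun=> c 0%N))) => -[|i] /=.
  move=> _; rewrite [LHS]fprod_lift_inr; exact: free_lift_gen.
rewrite size_map ltnS => lt_i; rewrite (nth_map 1) //.
by rewrite [LHS]fprod_lift_inl; apply: thetaE.
Qed.

(** The moves are arbitrary and only the two resulting tuples are tested; this is what makes a list
    of moves a certificate. *)
Lemma ideal_generators g (hs : seq (subgroup_of H)) ms1 ms2 :
  spans hs ->
  let b := [seq h <- gmoves hs ms1 | h != 1] in
  nielsen_reduced (map val b) ->
  let s := gmoves (adjoin_family b) ms2 in
  nielsen_reduced (map (eval_at H g) [seq y <- s | eval_at H g y != 1]) ->
  normal_closure [set` [seq y <- s | eval_at H g y == 1]] = ideal H g /\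
  is_basis [set` s].
Proof.
move=> hs_span b b_red s s_red.
have b_span : spans b by exact: spans_filter (spans_nmoves hs_span).
have b_ext : extends b := nielsen_reduced_extends b_span b_red.
have s_span : spans s by exact: spans_nmoves (spans_adjoin b_span).
have s_ext : extends s by exact: extends_nmoves (extends_adjoin b_ext).
split; first exact: normal_closure_kernel.
exact: spans_is_basis.
Qed.

Lemma map_gmoves (G K : groupType) (f : {multiplicative G -> K}) s ms :
  map f (gmoves s ms) = gmoves (map f s) ms.
Proof.
apply: map_nmoves; [exact: gmulfM|exact: multiplicativeV|exact: multiplicative1].
Qed.

Lemma map_val_filter (hs : seq (subgroup_of H)) :
  map val [seq h <- hs | h != 1] = [seq x <- map val hs | x != 1].
Proof. by rewrite filter_map. Qed.

(** Both reductions are found in F_n, for the images of the tuples; the same moves are then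
    performed in H and in H * <x>, since homomorphisms commute with moves. *)
Lemma exists_moves g (hs : seq (subgroup_of H)) :
  exists ms1, let b := [seq h <- gmoves hs ms1 | h != 1] in
  exists2 ms2, nielsen_reduced (map val b) &
  let s := gmoves (adjoin_family b) ms2 in
  nielsen_reduced (map (eval_at H g) [seq y <- s | eval_at H g y != 1]).
Proof.
have [ms1 red1] := nielsen_reduction (map val hs).
exists ms1; set b := [seq h <- _ | _].
have [ms2 red2] := nielsen_reduction (map (eval_at H g) (adjoin_family b)).
exists ms2.
  rewrite map_val_filter.
  have -> : map val (gmoves hs ms1) = gmoves (map val hs) ms1.
    exact: (map_gmoves (\val : {multiplicative subgroup_of H -> 'F n})).
  by [].
by move: red2; rewrite -map_gmoves filter_map.
Qed.

Lemma fin_generated_spans : fin_generated H ->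
  exists hs : seq (subgroup_of H), spans hs.
Proof.
move=> [s sE].
have s_H x : x \in s -> x \in H by move=> xs; rewrite sE; apply: mem_generated.
exists (pmap insub s); apply: spans_generated => x; rewrite sE.
suff -> : [set` map val (pmap insub s : seq (subgroup_of H))] = [set` s] by [].
apply/seteqP; split=> y /=.
  by case/mapP => h; rewrite mem_pmap_sub => hs ->.
move=> ys; apply/mapP; exists (Sub y (s_H y ys)); last by rewrite SubK.
by rewrite mem_pmap_sub SubK.
Qed.

End Ideal.

(** * The algorithm *)

Section CodedWords.
Implicit Types (u v w : seq nat) (L : seq (seq nat)).

(** This and the next three functions are [inv_letter], [push], [word_mul] and [word_inv] on letter
    codes. The type of words in x and the generators depends on the number of generators, whereas a
    single recursive function has to treat all inputs. *)
Definition ninv l := if odd l then l.-1 else l.+1.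

Definition npush l w :=
  if w is l' :: w' then if l' == ninv l then w' else l :: w else [:: l].

Definition nmul u v := foldr npush v u.

Definition nwinv w := rev (map ninv w).

Definition nval L u := foldr (fun l v =>
  nmul (if odd l then nwinv (nth [::] L l./2) else nth [::] L l./2) v) [::] u.

(* A certificate c lists the moves of the two reductions. Letters are coded as in
   [word_code]: the words [:: 2], ..., [:: 2k] stand for the given generators of H
   and [:: 0] stands for x; nval L maps the letter of index i to the i-th word of
   L, so x is mapped to the head of L. *)
Definition label_basis L (c : seq (seq (seq nat))) :=
  [seq u <- nmoves cat nwinv [::] [seq [:: j.*2] | j <- iota 1 (size L).-1]
              (nth [::] c 0) | nval L u != [::]].

(** Labels are multiplied by concatenation, without cancellation: they merely name elements of H *
    <x>, and every test is made on their values under [nval]. *)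
Definition label_family L c :=
  nmoves cat nwinv [::] ([:: 0] :: label_basis L c) (nth [::] c 1).

Definition certifies L c :=
  nreduced nmul nwinv [::] size (map (nval L) (label_basis L c)) &&
  nreduced nmul nwinv [::] size
    (map (nval L) [seq u <- label_family L c | nval L u != [::]]).

Definition label_kernel L c := [seq u <- label_family L c | nval L u == [::]].

Definition valid n L :=
  (0 < size L) && all (fun w => all (fun l => l < n.*2) w) L.

End CodedWords.

(* Computability of the certificate test and of its output *)
Create HintDb computable.

Ltac computable_tac :=
  cbv beta;
  lazymatch goal with
  | |- computable (fun _ => _) => idtac
  | |- computable ?f => change (computable (fun c => f c))
  end;
  lazymatch goal with
  | |- computable (fun c => (_, _)) => apply: computable_pair; computable_tac
  | |- computable (fun c => fst _) => apply: computable_fst; computable_tac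
  | |- computable (fun c => snd _) => apply: computable_snd; computable_tac
  | |- computable (fun c => c) => exact: computable_id
  | |- computable (fun c => addn _ _) => apply: computable_addn; computable_tac
  | |- computable (fun c => subn _ _) => apply: computable_subn; computable_tac
  | |- computable (fun c => S _) => apply: computable_succn; computable_tac
  | |- computable (fun c => predn _) => apply: computable_predn; computable_tac
  | |- computable (fun c => double _) => apply: computable_double; computable_tac
  | |- computable (fun c => odd _) => apply: computable_odd; computable_tac
  | |- computable (fun c => half _) => apply: computable_half; computable_tac
  | |- computable (fun c => leq _ _) => apply: computable_leq; computable_tac
  | |- computable (fun c => negb _) => apply: computable_negb; computable_tac
  | |- computable (fun c => andb _ _) => apply: computable_andb; computable_tac
  | |- computable (fun c => implb _ _) =>
      apply: computable_implb; computable_tac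
  | |- computable (fun c => if _ then _ else _) =>
      apply: computable_if; computable_tac
  | |- computable (fun c => cons _ _) => apply: computable_cons; computable_tac
  | |- computable (fun c => rev _) => apply: computable_rev; computable_tac
  | |- computable (fun c => size _) => apply: computable_size; computable_tac
  | |- computable (fun c => _ ++ _) => apply: computable_cat; computable_tac
  | |- computable (fun c => nth _ _ _) => apply: computable_nth; computable_tac
  | |- computable (fun c => iota _ _) => apply: computable_iota; computable_tac
  | |- computable (fun c => map _ _) => apply: computable_map; computable_tac
  | |- computable (fun c => all _ _) => apply: computable_all; computable_tac
  | |- computable (fun c => filter _ _) =>
      apply: computable_filter; computable_tac
  | |- computable (fun c => foldr _ _ _) =>
      apply: computable_foldr; computable_tac
  | |- computable (fun c => foldl _ _ _) =>
      apply: computable_foldl; computable_tac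
  | |- computable (fun c => @eq_op Datatypes_nat__canonical__eqtype_Equality _ _) =>
      apply: computable_eqn; computable_tac
  | |- computable (fun c => eq_op _ _) => apply: computable_eqseq; computable_tac
  | |- computable _ => first
      [exact: computable_const | assumption | solve [auto 1 with computable nocore]]
  end.

Lemma computable_lift2 (A B C D : Type) {_ : encodable A} {_ : encodable B}
    {_ : encodable C} {_ : encodable D} (h : A -> B -> D) (f : C -> A) (g : C -> B) :
  computable (fun p : A * B => h p.1 p.2) -> computable f -> computable g ->
  computable (fun c => h (f c) (g c)).
Proof.
move=> hc fc gc.
exact: (computable_comp (f := fun c => (f c, g c)) hc (computable_pair fc gc)).
Qed.

Lemma computable_ninv : computable ninv.
Proof.
have h : computable (fun l => if odd l then l - 1 else l + 1) by computable_tac.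
by apply: computable_ext h => l; rewrite addn1 subn1.
Qed.

#[local] Hint Extern 0 (computable (fun c => ninv _)) =>
  apply: (computable_comp computable_ninv); computable_tac : computable.

Lemma computable_npush : computable (fun p : nat * seq nat => npush p.1 p.2).
Proof. by rewrite /npush; apply: computable_case; computable_tac. Qed.

#[local] Hint Extern 0 (computable (fun c => npush _ _)) =>
  apply: (computable_lift2 computable_npush); computable_tac : computable.

Lemma computable_nmul : computable (fun p : seq nat * seq nat => nmul p.1 p.2).
Proof. by rewrite /nmul; computable_tac. Qed.

#[local] Hint Extern 0 (computable (fun c => nmul _ _)) =>
  apply: (computable_lift2 computable_nmul); computable_tac : computable.

Lemma computable_nwinv : computable nwinv.
Proof. by rewrite /nwinv; computable_tac. Qed.

#[local] Hint Extern 0 (computable (fun c => nwinv _)) =>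
  apply: (computable_comp computable_nwinv); computable_tac : computable.

Lemma computable_nval : computable (fun p : seq (seq nat) * seq nat => nval p.1 p.2).
Proof. by rewrite /nval; computable_tac. Qed.

#[local] Hint Extern 0 (computable (fun c => nval _ _)) =>
  apply: (computable_lift2 computable_nval); computable_tac : computable.

Lemma computable_nmove :
  computable (fun p : seq (seq nat) * seq nat => nmove cat nwinv [::] p.1 p.2).
Proof. by rewrite /nmove /twist; computable_tac. Qed.

#[local] Hint Extern 0 (computable (fun c => nmove _ _ _ _ _)) =>
  apply: (computable_lift2 computable_nmove); computable_tac : computable.

Lemma computable_nmoves :
  computable (fun p : seq (seq nat) * seq (seq nat) => nmoves cat nwinv [::] p.1 p.2).
Proof. by rewrite /nmoves; computable_tac. Qed.

#[local] Hint Extern 0 (computable (fun c => nmoves _ _ _ _ _)) =>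
  apply: (computable_lift2 computable_nmoves); computable_tac : computable.

(** Reduces absence of repetitions to filtering, counting and a bounded quantifier, whose
    computability is already established. *)
Lemma uniq_all_count (A : eqType) (s : seq A) :
  uniq s = all (fun x => size [seq y <- s | y == x] <= 1) s.
Proof.
apply/idP/allP => [s_uniq x xs|h].
  by rewrite size_filter count_uniq_mem // leq_b1.
apply: count_mem_uniq => x; have [xs|xs] := boolP (x \in s).
  apply/eqP; rewrite eqn_leq -size_filter h //= size_filter -has_count has_pred1.
  by rewrite xs.
by apply/count_memPn.
Qed.

Lemma computable_nreduced : computable (nreduced nmul nwinv [::] size).
Proof.
have h : computable (fun s : seq (seq nat) => s ++ map nwinv s) by computable_tac.
apply: (computable_comp (h := fun P => uniq P &&
  all (fun x => all (fun y => (nmul x y != [::]) ==> (size y <= size (nmul x y)) &&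
    all (fun z => (nmul y z != [::]) ==>
      (size x + size z < size (nmul x y) + size (nmul y z))) P) P) P) _ h).
apply: computable_andb; last by computable_tac.
have e : computable (fun P : seq (seq nat) =>
    all (fun x => size [seq y <- P | y == x] <= 1) P).
  by computable_tac.
by apply: computable_ext e => P; rewrite uniq_all_count.
Qed.

#[local] Hint Extern 0 (computable (fun c => nreduced _ _ _ _ _)) =>
  apply: (computable_comp computable_nreduced); computable_tac : computable.

Definition certificate := (seq (seq nat) * seq (seq (seq nat)))%type.

Lemma computable_label_basis : computable (fun p : certificate => label_basis p.1 p.2).
Proof. by rewrite /label_basis; computable_tac. Qed.

#[local] Hint Extern 0 (computable (fun c => label_basis _ _)) =>
  apply: (computable_lift2 computable_label_basis); computable_tac : computable.

Lemma computable_label_family : computable (fun p : certificate => label_family p.1 p.2).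
Proof. by rewrite /label_family; computable_tac. Qed.

#[local] Hint Extern 0 (computable (fun c => label_family _ _)) =>
  apply: (computable_lift2 computable_label_family); computable_tac : computable.

Lemma computable_certifies : computable (fun p : certificate => certifies p.1 p.2).
Proof. by rewrite /certifies; computable_tac. Qed.

Lemma computable_label_kernel : computable (fun p : certificate => label_kernel p.1 p.2).
Proof. by rewrite /label_kernel; computable_tac. Qed.

Lemma computable_valid n : computable (valid n).
Proof. by rewrite /valid; computable_tac. Qed.

(** * From coded labels to elements of F_n and of H * <x> *)

Section Coding.
Variables (T : choiceType) (c : T -> nat).
Implicit Types (u v : word T).

Definition code_word u : seq nat := map (code_letter c) u.

Lemma code_letter_inv l : code_letter c (inv_letter l) = ninv (code_letter c l).
Proof.
rewrite /ninv odd_code_letter; case: l => t [].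
  by rewrite /code_letter /= addn1 addn0.
by rewrite /code_letter /= addn1 addn0.
Qed.

Lemma code_word_inv u : code_word (word_inv u) = nwinv (code_word u).
Proof.
rewrite /code_word /word_inv map_rev; congr rev; rewrite -!map_comp.
by apply: eq_map => l; apply: code_letter_inv.
Qed.

Lemma code_word_mul u v : injective c ->
  code_word (word_mul u v) = nmul (code_word u) (code_word v).
Proof.
move=> c_inj; elim: u => //= l u <-; case: (word_mul u v) => //= l' w.
rewrite -code_letter_inv (inj_eq (code_letter_inj c_inj)).
by case: ifP.
Qed.

Lemma code_word_inj : injective c -> injective code_word.
Proof. by move=> c_inj; apply/inj_map/code_letter_inj. Qed.

End Coding.

Section Certificates.
Local Open Scope group_scope.
Variables (n : nat) (w : word 'I_n) (ws : seq (word 'I_n)).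
Local Notation k := (size ws).
Local Notation code := (code_word (@nat_of_ord n)).
Local Notation lcode := (code_word (@letter_code k)).
Local Notation L := (map code (w :: ws)).
Local Notation H := (span ws).
Local Notation g := (word_val w).
Implicit Types u v : word (option 'I_k).

Lemma eval_adjoin_word_val u : eval_at H g (adjoin_word_val u) =
  eval_word (fun o => word_val (nth [::] (w :: ws) (letter_code o))) u.
Proof.
rewrite multiplicative_eval_word; congr (eval_word _ _); apply: funext => -[i|] /=.
  by rewrite eval_at_H /= (tnth_nth [::]).
exact: eval_at_x.
Qed.

(** On the code of a label, [nval] yields the reduced word of its image under phi_g; comparing codes
    therefore decides equality of the images in F_n. *)
Lemma nval_code u : nval L (lcode u) = code (val (eval_at H g (adjoin_word_val u))).
Proof.
rewrite eval_adjoin_word_val; set W := fun o => _.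
elim: u => [|l u IHu]; first by rewrite /eval_word big_nil.
rewrite eval_word_cons [LHS]/= -/(nval L _) IHu.
rewrite odd_code_letter half_code_letter.
have -> : nth [::] L (letter_code l.1) = code (nth [::] (w :: ws) (letter_code l.1)).
  have [lt|ge] := ltnP (letter_code l.1) (size (w :: ws)).
    exact: nth_map.
  by rewrite !nth_default ?size_map.
rewrite -code_word_inv -fun_if -code_word_mul; last exact: val_inj.
have -> : eval_letter W l = eval_word (@free_gen _)
    (if l.2 then word_inv (nth [::] (w :: ws) (letter_code l.1))
     else nth [::] (w :: ws) (letter_code l.1)).
  by rewrite /eval_letter; case: ifP; rewrite ?eval_word_inv.
by rewrite val_eval_word_free_gen.
Qed.

Definition span_gens : seq (subgroup_of H) := [seq span_gen i | i <- enum 'I_k].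

Lemma spans_span_gens : spans span_gens.
Proof.
apply: spans_generated => x; rewrite -[x \in H]/(x \in generated _).
suff -> : map val span_gens = map (@word_val n) ws by [].
have e : map (tnth (in_tuple ws)) (enum 'I_k) = ws := map_tnth_enum _.
by rewrite -[in RHS]e -!map_comp; apply: eq_map.
Qed.

Variables ms1 ms2 : seq (seq nat).

Let b := [seq h <- gmoves span_gens ms1 | h != 1].
Let s := gmoves (adjoin_family b) ms2.
(** Labels running parallel to the tuples in the groups: t names the moved generators of H, [bw] the
    entries of b, and [sw] those of s. *)
Let t := nmoves cat (@word_inv _) [::] [seq [:: (Some i, false)] | i <- enum 'I_k] ms1.
Let bw := [seq u <- t | eval_at H g (adjoin_word_val u) != 1].
Let sw := nmoves cat (@word_inv _) [::] ([:: (None, false)] :: bw) ms2.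

Lemma map_lcode us ms : map lcode (nmoves cat (@word_inv _) [::] us ms) =
  nmoves cat nwinv [::] (map lcode us) ms.
Proof. by apply: map_nmoves => // [x y|x]; [apply: map_cat|apply: code_word_inv]. Qed.

Lemma map_adjoin_word_val us ms :
  map (@adjoin_word_val n ws) (nmoves cat (@word_inv _) [::] us ms) =
  gmoves (map (@adjoin_word_val n ws) us) ms.
Proof.
apply: map_nmoves => [x y|x|]; first exact: eval_word_cat.
  exact: eval_word_inv.
by rewrite /adjoin_word_val /eval_word big_nil.
Qed.

Lemma code_val_eq0 (x : 'F n) : (code (val x) == [::]) = (x == 1).
Proof. by rewrite -size_eq0 size_map -/(len x) len_eq0. Qed.

Lemma label_basis_code : label_basis L [:: ms1; ms2] = map lcode bw.
Proof.
rewrite /label_basis /= size_map.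
have -> : [seq [:: j.*2] | j <- iota 1 k] =
          map lcode [seq [:: (Some i, false)] | i <- enum 'I_k].
  rewrite -map_comp (iotaDl 1) -val_enum_ord -!map_comp.
  by apply: eq_map => i; rewrite /= /code_letter /= addn0 add1n.
rewrite -map_lcode filter_map; congr map; apply: eq_filter => u /=.
by rewrite nval_code code_val_eq0.
Qed.

Lemma label_family_code : label_family L [:: ms1; ms2] = map lcode sw.
Proof. by rewrite /label_family label_basis_code map_lcode. Qed.

Lemma label_kernel_code : label_kernel L [:: ms1; ms2] =
  map lcode [seq u <- sw | eval_at H g (adjoin_word_val u) == 1].
Proof.
rewrite /label_kernel label_family_code filter_map; congr map.
by apply: eq_filter => u /=; rewrite nval_code code_val_eq0.
Qed.

(** A label is discarded when phi_g of its value is trivial, an element of H when it is itself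
    trivial; the two criteria agree because phi_g is the inclusion on H. *)
Lemma adjoin_word_val_basis : map (@adjoin_word_val n ws) bw =
  map (fprod_inl (free_group unit)) b.
Proof.
have e : map (@adjoin_word_val n ws) t =
         map (fprod_inl (free_group unit)) (gmoves span_gens ms1).
  rewrite map_adjoin_word_val map_gmoves; congr gmoves.
  rewrite -!map_comp; apply: eq_map => i /=.
  by rewrite /adjoin_word_val /eval_word big_seq1.
have := congr1 (filter (fun y => eval_at H g y != 1)) e.
rewrite !filter_map => ->; congr map; apply: eq_filter => h /=.
by rewrite eval_at_H.
Qed.

Lemma adjoin_word_val_family : map (@adjoin_word_val n ws) sw = s.
Proof.
rewrite map_adjoin_word_val /= adjoin_word_val_basis; congr (gmoves (_ :: _) _).
by rewrite /adjoin_word_val /eval_word big_seq1.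
Qed.

Lemma map_nval_code us : map (nval L) (map lcode us) =
  map (code \o val) (map (eval_at H g) (map (@adjoin_word_val n ws) us)).
Proof. by rewrite -!map_comp; apply: eq_map => u; apply: nval_code. Qed.

Lemma nreduced_code (xs : seq 'F n) :
  nreduced nmul nwinv [::] size (map (code \o val) xs) = nielsen_reduced xs.
Proof.
apply: map_nreduced => [x y|x||x y|x] //=.
- exact/code_word_mul/val_inj.
- exact: code_word_inv.
- by move=> e; apply: val_inj; apply: code_word_inj e; apply: val_inj.
- by rewrite size_map.
Qed.

Lemma certifiesE : certifies L [:: ms1; ms2] =
  nielsen_reduced (map val b) &&
  nielsen_reduced (map (eval_at H g) [seq y <- s | eval_at H g y != 1]).
Proof.
rewrite /certifies label_basis_code label_family_code filter_map !map_nval_code.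
rewrite !nreduced_code adjoin_word_val_basis; congr andb; congr nielsen_reduced.
  by rewrite -map_comp; apply: eq_map => h /=; rewrite eval_at_H.
rewrite -adjoin_word_val_family filter_map; congr map; congr map.
by apply: eq_filter => u /=; rewrite nval_code code_val_eq0.
Qed.

Lemma certifies_sound : certifies L [:: ms1; ms2] ->
  exists us : seq (word (option 'I_k)),
    label_kernel L [:: ms1; ms2] = map lcode us /\
    let S := [set` map (@adjoin_word_val n ws) us] in
    normal_closure S = ideal H g /\
    exists2 B : set (adjoin H), is_basis B & S `<=` B.
Proof.
rewrite certifiesE => /andP[b_red s_red].
have [kerE s_basis] := ideal_generators spans_span_gens b_red s_red.
exists [seq u <- sw | eval_at H g (adjoin_word_val u) == 1].
split; first exact: label_kernel_code.
have -> : map (@adjoin_word_val n ws) [seq u <- sw | eval_at H g (adjoin_word_val u) == 1]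
   = [seq y <- s | eval_at H g y == 1].
  by rewrite -adjoin_word_val_family filter_map.
split=> //; exists [set` s] => // y /=.
by rewrite mem_filter => /andP[].
Qed.

End Certificates.

Lemma exists_certificate n (w : word 'I_n) (ws : seq (word 'I_n)) :
  exists c, certifies (map (code_word (@nat_of_ord n)) (w :: ws)) c.
Proof.
have [ms1 [ms2 red1 red2]] := exists_moves (word_val w) (span_gens ws).
by exists [:: ms1; ms2]; rewrite certifiesE red1 red2.
Qed.

Lemma encode_words (T : choiceType) (c : T -> nat) (us : seq (word T)) :
  words_code c us = encode (map (code_word c) us).
Proof.
rewrite /encode /seq_encodable -map_comp; congr CodeSeq.code; apply: eq_map => u /=.
by rewrite /encode /nat_encodable map_id.
Qed.

Lemma valid_code n (w : word 'I_n) (ws : seq (word 'I_n)) :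
  valid n (map (code_word (@nat_of_ord n)) (w :: ws)).
Proof.
apply/andP; split=> //; apply/allP => _ /mapP[u _ ->].
apply/allP => _ /mapP[[i b] _ ->]; rewrite /code_letter /=.
by have := ltn_ord i; case: b; lia.
Qed.

Lemma validP n L : valid n L ->
  exists w ws, L = map (code_word (@nat_of_ord n)) (w :: ws).
Proof.
have codeP v : all (fun l => l < n.*2) v -> exists u, code_word (@nat_of_ord n) u = v.
  elim: v => [|l v IHv] /=; first by exists [::].
  case/andP => lt_l /IHv[u <-].
  have lt_i : l./2 < n by lia.
  exists ((Ordinal lt_i, odd l) :: u).
  by rewrite /= /code_letter /= addnC odd_double_half.
case/andP => L_gt0 L_letters.
have [us LE] : exists us, map (code_word (@nat_of_ord n)) us = L.
  elim: L L_letters {L_gt0} => [|v L IHL] /=; first by exists [::].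
  by case/andP => /codeP[u <-] /IHL[us <-]; exists (u :: us).
by case: us LE L_gt0 => [<-|w ws <-] // _; exists w, ws.
Qed.

Theorem theorem3p6 (n : nat) :
  (forall (H : groupClosed 'F n) (g : 'F n), fin_generated H ->
     (exists S : seq (adjoin H), normal_closure [set` S] = ideal H g)
     /\
     (exists (S : seq (adjoin H)) (B : set (adjoin H)),
        [/\ normal_closure [set` S] = ideal H g, is_basis B & [set` S] `<=` B]))
  /\
  (exists2 f : nat -> nat, recursive1 f &
     forall (ws : seq (word 'I_n)) (w : word 'I_n),
       exists us : seq (word (option 'I_(size ws))),
         f (words_code (@nat_of_ord n) (w :: ws))
           = words_code (@letter_code (size ws)) us /\
         let S := [set` map (@adjoin_word_val n ws) us] in
         normal_closure S = ideal (span ws) (word_val w) /\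
         exists2 B : set (adjoin (span ws)), is_basis B & S `<=` B).
Proof.
split.
  move=> H g /fin_generated_spans[hs hs_span].
  have [ms1 [ms2 red1 red2]] := exists_moves g hs.
  have [kerE s_basis] := ideal_generators hs_span red1 red2.
  split; first by eexists; apply: kerE.
  eexists; eexists; split; [exact: kerE|exact: s_basis|].
  by move=> y /=; rewrite mem_filter => /andP[].
(* Regular minimization has to succeed on every number, so the condition is made vacuous on lists
   that do not code an input for this n. *)
pose a L c := valid n L ==> certifies L c.
have ac : computable (fun p : certificate => a p.1 p.2).
  apply: computable_implb; last exact: computable_certifies.
  by apply: (computable_comp (computable_valid n)); computable_tac.
have [|c cc cP] := computable_search (encode_seqK (encode_seqK (fun x => erefl)))
  (encode_seqK (encode_seqK (encode_seqK (fun x => erefl)))) ac.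
  move=> L; have [/validP[w [ws ->]]|nv] := boolP (valid n L).
    by have [c cP] := exists_certificate w ws; exists c; rewrite /a cP implybT.
  by exists [::]; rewrite /a (negbTE nv).
have [f fr fE] := computable_lift2 computable_label_kernel computable_id cc.
exists f => // ws w; rewrite encode_words fE.
have := cP (map (code_word (@nat_of_ord n)) (w :: ws)).
rewrite /a valid_code /=; set d := c _ => d_cert.
(* The certificate found is a list of any length, but only its entries 0 and 1, empty by default,
   are ever read. *)
have [us [usE us_gen]] := @certifies_sound n w ws (nth [::] d 0) (nth [::] d 1) d_cert.
exists us; rewrite encode_words -usE.
split=> //.
Qed.
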